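(* Let $\mathcal{K}=\{x\in\mathbb{R}^n: g_1(x)\ge 0,\ldots,g_q(x)\ge 0\}$ be a basic semialgebraic set, and let $B^*$ and $B^*_{d,\nu}$ be the optimal values of the polynomial matrix inequality problem and of its sparsity-exploiting SOS reformulation defined in the context. Suppose that $P(x,\lambda) = \sum_{|\alpha|\leq 2\delta} P_\alpha(\lambda) x^\alpha$ is an inhomogeneous polynomial matrix of even degree $2\delta$ in $x$ such that $\sum_{|\alpha|= 2\delta} P_\alpha(\lambda) x^\alpha$ is positive semidefinite on $\mathbb{R}^n$ for all $\lambda \in \mathbb{R}^\ell$. If there exists $\lambda_0 \in \mathbb{R}^\ell$ such that $P(x, \lambda_0)$ is strictly positive definite on $\mathcal{K}$ and such that $\sum_{|\alpha|= 2\delta} P_\alpha(\lambda_0) x^\alpha$ is strictly positive definite on $\mathbb{R}^n \setminus\{0\}$, then $B_{d,\nu}^* \to B^*$ from above as $\nu \to \infty$ with $d = \nu + \lceil\frac12 \max\{\deg(P), \deg(g_1), \ldots, \deg(g_q)\}\rceil$ and $\sigma(x) = 1+\|x\|^2$.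
   Context: Polynomials have real coefficients, $x=(x_1,\ldots,x_n)$, $\|x\|^2=x_1^2+\cdots+x_n^2$; for a multi-index $\alpha\in\mathbb{N}^n$, $|\alpha|=\alpha_1+\cdots+\alpha_n$ and $x^\alpha=x_1^{\alpha_1}\cdots x_n^{\alpha_n}$. Let $b:\mathbb{R}^\ell\to\mathbb{R}$ be convex, let $P_0,\ldots,P_\ell$ be $m\times m$ symmetric polynomial matrices in $x$, let $P(x,\lambda):=P_0(x)-\sum_{i=1}^\ell P_i(x)\lambda_i$ for $\lambda\in\mathbb{R}^\ell$ (so that its coefficient matrices $P_\alpha(\lambda)$, indexed by multi-indices $\alpha$, are affine in $\lambda$), and let $g_1,\ldots,g_q$ be the polynomials defining $\mathcal{K}$. The polynomial matrix inequality problem is $$B^* := \inf_{\lambda\in\mathbb{R}^\ell} b(\lambda)\quad\text{s.t.}\quad P(x,\lambda)\succeq 0\ \ \forall x\in\mathcal{K}.$$ The sparsity graph of $P$ is the undirected graph with vertices $\{1,\ldots,m\}$ in which, for $i\neq j$, $(i,j)$ is not an edge if and only if $P_{ij}(x,\lambda)$ vanishes identically (in $x$ and $\lambda$). It is assumed to be chordal (every cycle of length at least $4$ has an edge joining two nonconsecutive vertices), with maximal cliques $\mathcal{C}_1,\ldots,\mathcal{C}_t$ (a clique is a set of pairwise adjacent vertices; it is maximal if not contained in another clique). For a clique $\mathcal{C}$ with elements $\mathcal{C}(1)<\cdots<\mathcal{C}(|\mathcal{C}|)$, $E_{\mathcal{C}}\in\mathbb{R}^{|\mathcal{C}|\times m}$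 has $(E_{\mathcal{C}})_{ij}=1$ if $\mathcal{C}(i)=j$ and $0$ otherwise. A polynomial matrix $S(x)$ is SOS if $S=H^{\mathsf T}H$ for some (possibly rectangular) polynomial matrix $H$. $\Sigma^{p}_{2\omega}$ denotes the cone of $p\times p$ SOS matrices in $n$ variables of degree at most $2\omega$. For integers $\nu\ge 0$ and $d$ with $2d\ge\max\{\deg(P),\deg(g_1),\ldots,\deg(g_q)\}+2\nu$ (degrees in $x$) and a polynomial $\sigma$, the SOS reformulation is $$B_{d,\nu}^* := \inf_{\lambda,\,S_{j,k}} b(\lambda)\quad\text{s.t.}\quad \sigma(x)^\nu P(x,\lambda)=\sum_{k=1}^t E_{\mathcal{C}_k}^{\mathsf T}\Big(S_{0,k}(x)+\sum_{j=1}^q g_j(x)S_{j,k}(x)\Big)E_{\mathcal{C}_k},\quad S_{j,k}\in\Sigma^{|\mathcal{C}_k|}_{2d_j}\ \ (j=0,\ldots,q,\ k=1,\ldots,t),$$ where $d_0:=d$ and $d_j:=d-\lceil\tfrac12\deg(g_j)\rceil$ for $j=1,\ldots,q$. The infimum over an empty set is $+\infty$. *)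

(* Defs.v *)
From HB Require Import structures.
(* mpoly must be imported before the MathComp-Analysis files: in the opposite
   order their notations clash. *)
From mathcomp Require Import all_boot all_order all_algebra mpoly.
From mathcomp Require Import boolp classical_sets reals constructive_ereal.
From mathcomp Require Import ereal topology normedtype sequences convex.

Set Implicit Arguments.
Unset Strict Implicit.
Unset Printing Implicit Defensive.

Import Order.TTheory GRing.Theory Num.Theory.

Local Open Scope classical_set_scope.
Local Open Scope ring_scope.

Section Graphs.
Variables (T : finType) (e : rel T).

Definition chordal : Prop :=
  forall c : seq T, (4 <= size c)%N -> ucycle e c ->
    exists x y : T,
      [/\ x \in c, y \in c, e x y, y != next c x & x != next c y].

Definition clique (C : {set T}) : bool :=
  [forall x in C, forall y in C, (x != y) ==> e x y].

Definition maximal_clique (C : {set T}) : bool := maxset clique C.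

Definition enumerates_maximal_cliques (t : nat) (C : 'I_t -> {set T}) : Prop :=
  injective C /\
  forall D : {set T}, maximal_clique D <-> exists k : 'I_t, C k = D.

End Graphs.

Section RealMatrices.
Variables (R : realType) (m : nat).

Definition posdef (M : 'M[R]_m) : Prop :=
  M^T = M /\ forall v : 'cV[R]_m, v != 0 -> 0 < (v^T *m M *m v) 0 0.

Definition possemidef (M : 'M[R]_m) : Prop :=
  M^T = M /\ forall v : 'cV[R]_m, 0 <= (v^T *m M *m v) 0 0.

End RealMatrices.

Section PolynomialMatrices.
Variables (R : realType) (n : nat).

(* The zero polynomial has degree 0. *)
Definition mpdeg (p : {mpoly R[n]}) : nat := (msize p).-1.

Definition mxdeg (p q : nat) (A : 'M[{mpoly R[n]}]_(p, q)) : nat :=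
  (\max_(i < p) \max_(j < q) mpdeg (A i j))%N.

Definition mxeval (x : 'rV[R]_n) (p q : nat) (A : 'M[{mpoly R[n]}]_(p, q)) :
    'M[R]_(p, q) :=
  map_mx (meval (fun i => x 0 i)) A.

Definition hom_part (d : nat) (p q : nat) (A : 'M[{mpoly R[n]}]_(p, q)) :
    'M[{mpoly R[n]}]_(p, q) :=
  map_mx (pihomog mdeg d) A.

(* The cone of p x p SOS matrices of degree at most dg. *)
Definition sos_cone (p dg : nat) : set 'M[{mpoly R[n]}]_p :=
  [set S | (exists (h : nat) (H : 'M[{mpoly R[n]}]_(h, p)), S = H^T *m H) /\
           (mxdeg S <= dg)%N].

Definition semialg (q : nat) (g : 'I_q -> {mpoly R[n]}) : set 'rV[R]_n :=
  [set x | forall j, 0 <= (g j).@[fun i => x 0 i]].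

Definition one_plus_normsq : {mpoly R[n]} := 1 + \sum_(i < n) 'X_i ^+ 2.

End PolynomialMatrices.

(* enum_val lists the elements of C in increasing order. *)
Definition clique_mx (A : nzRingType) (m : nat) (C : {set 'I_m}) :
    'M[A]_(#|C|, m) :=
  \matrix_(i, j) (enum_val i == j)%:R.

Section PMI.
Variables (R : realType) (n m l : nat).
Variables (P0 : 'M[{mpoly R[n]}]_m) (P : 'I_l -> 'M[{mpoly R[n]}]_m).

Definition pencil (lam : 'rV[R]_l) : 'M[{mpoly R[n]}]_m :=
  P0 - \sum_(i < l) (lam 0 i)%:MP *: P i.

(* Degree in x of pencil, its coefficients being functions of lam: x^alpha
   occurs iff its coefficient is nonzero in P0 or in some P i. *)
Definition pencil_deg : nat := maxn (mxdeg P0) (\max_(i < l) mxdeg (P i)).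

Definition pencil_homogeneous (d : nat) : Prop :=
  forall lam i j, pencil lam i j \is d.-homog.

Definition sparsity_graph : rel 'I_m :=
  fun i j => (i != j) &&
    ~~ `[< forall (lam : 'rV[R]_l) (x : 'rV[R]_n),
             mxeval x (pencil lam) i j = 0 >].

Variables (b : 'rV[R]_l -> R) (q : nat) (g : 'I_q -> {mpoly R[n]}).

Definition pmi_feasible : set 'rV[R]_l :=
  [set lam | forall x, semialg g x -> possemidef (mxeval x (pencil lam))].

Definition pmi_value : \bar R :=
  ereal_inf [set (b lam)%:E | lam in pmi_feasible].

Variables (t : nat) (C : 'I_t -> {set 'I_m}).

(* The truncated subtraction defining the degree of S j k is exact as soon as
   2 * d >= deg (g j); uphalf is the rounded-up half. *)
Definition sos_feasible (sigma : {mpoly R[n]}) (d nu : nat) : set 'rV[R]_l :=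
  [set lam | exists (S0 : forall k : 'I_t, 'M[{mpoly R[n]}]_#|C k|)
                    (S : forall (j : 'I_q) (k : 'I_t), 'M[{mpoly R[n]}]_#|C k|),
    [/\ forall k, sos_cone (2 * d) (S0 k),
        forall j k, sos_cone (2 * (d - uphalf (mpdeg (g j)))) (S j k)
      & sigma ^+ nu *: pencil lam =
        \sum_(k < t) (clique_mx _ (C k))^T
          *m (S0 k + \sum_(j < q) g j *: S j k) *m clique_mx _ (C k)]].

Definition sos_value (sigma : {mpoly R[n]}) (d nu : nat) : \bar R :=
  ereal_inf [set (b lam)%:E | lam in sos_feasible sigma d nu].

Definition min_relax_order (nu : nat) : nat :=
  (nu + uphalf (maxn pencil_deg (\max_(j < q) mpdeg (g j))))%N.

End PMI.

(* Main.v *)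
(* A chordal positive semidefinite matrix is a sum of positive semidefinite
   matrices supported on the cliques, so it suffices to write
     sigma^nu P = sum_w r_w^2 B_w + sum_j g_j s_j I
   with constant positive semidefinite matrices B_w having the sparsity of P and
   scalar sums of squares s_j.  Put z = (1, x), let u be the vector of all
   squares (z_i +- z_j)^2 scaled so that their sum is sigma, and let Y(u) be the
   linear matrix with Y(u(x)) = z z^T.  Then P and the g_j are pulled back to
   forms in Y(u), hence in u.  On the unit simplex the points with Y(u) = z z^T,
   |z| = 1, are cut out by a polynomial penalty, and they are the points of the
   projective closure of R^n: those with z_0 <> 0 are affine points, where P is
   positive definite on K, and those with z_0 = 0 are points at infinity, where
   the leading form is.  By compactness, subtracting G (1 - c G)^(2k) for each
   constraint G >= 0 (the g_j and minus the penalty) makes the pulled back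
   matrix positive definite on the whole simplex.  By Polya's theorem its product
   with a high power of sum_k u_k has positive definite coefficients, and
   substituting u(x) for u turns the monomials into squares and kills the
   penalty.  Convexity of b reduces the limit to strictly feasible lambda. *)
Require Import Defs.
From HB Require Import structures.
From mathcomp Require Import all_boot all_order all_algebra mpoly.
From mathcomp Require Import boolp classical_sets reals constructive_ereal.
From mathcomp Require Import ereal topology normedtype sequences convex.
From mathcomp Require Import derive.
From mathcomp Require Import ring lra zify.

Set Implicit Arguments.
Unset Strict Implicit.
Unset Printing Implicit Defensive.

Import Order.TTheory GRing.Theory Num.Theory.
Import numFieldNormedType.Exports.

Local Open Scope ring_scope.

(** * Simplicial vertices of chordal graphs *)

Section Dirac.
Variables (T : finType) (e : rel T).
Hypotheses (e_sym : ssrbool.symmetric e) (e_irr : irreflexive e).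
Hypothesis e_chordal : chordal e.

Definition simplicial (A : {set T}) (y : T) : Prop :=
  forall a b, a \in A -> b \in A -> e y a -> e y b -> a != b -> e a b.

(* A shortest path from u to v through H, closed up by x, would be a chordless
   cycle. *)
Lemma chordal_path_edge (H : {set T}) (x u v : T) (s : seq T) :
  x != u -> x != v -> u != v -> x \notin H -> e x u -> e x v ->
  {in H, forall h, ~~ e x h} ->
  path e u s -> last u s = v -> {subset u :: s <= u |: (v |: H)} -> e u v.
Proof.
move=> xu xv uv xH exu exv Hx; have [k] := ubnP (size s).
elim: k s => // k IHk s0 /ltnSE les0.
case/shortenP => s ps us subs lastv subH.
have ssz : (size s <= k)%N.
  apply: leq_trans les0; apply: uniq_leq_size; first by case/andP: us.
  by move=> z /subs.
have {}subH : {subset u :: s <= u |: (v |: H)}.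
  move=> z; rewrite inE => /orP [/eqP ->|/subs zs].
    by rewrite !inE eqxx.
  by apply: subH; rewrite inE zs orbT.
apply: contraT => nuv.
pose c := x :: u :: s.
have xc : x \notin u :: s.
  by apply/negP => /subH; rewrite !inE (negbTE xu) (negbTE xv) (negbTE xH).
have uc : uniq c by rewrite /c cons_uniq xc.
(* A chord between nonconsecutive vertices of the path would shorten it, and the induction
   hypothesis would give [e u v]. *)
have short p1 p2 p3 a b : u :: s = p1 ++ a :: p2 ++ b :: p3 -> e a b ->
    p2 = [::].
  case: p2 => // a' p2 E eab; exfalso; move/negP: nuv; apply.
  case: p1 E => [|u' p1] /= [Eu E].
    subst a; apply: (IHk (b :: p3)).
    - move: ssz; rewrite E /= size_cat /= => h.
      by apply: leq_trans h; rewrite ltnS leq_addl.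
    - by move: ps; rewrite E /= cat_path /= eab /=; case/and3P => _ _ /andP [].
    - by move: lastv; rewrite E /= last_cat.
    move=> z zin; apply: subH; move: zin; rewrite E !(inE, mem_cat).
    by case/or3P => ->; rewrite ?orbT.
  subst u'; apply: (IHk (p1 ++ a :: b :: p3)).
  - move: ssz; rewrite E /= !size_cat /= size_cat /= => h.
    by apply: leq_trans h; rewrite ltn_add2l !ltnS leq_addl.
  - move: ps; rewrite E !cat_path /= eab /= !cat_path /=.
    by case/and4P => -> -> _ /andP [_ /andP []].
  - by move: lastv; rewrite E !last_cat /= !last_cat /=.
  move=> z zin; apply: subH; move: zin; rewrite E !(inE, mem_cat).
  by case/orP => [->|/orP [->|/or3P [] ->]]; rewrite ?orbT.
have sz4 : (4 <= size c)%N.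
  rewrite /c /= !ltnS; case: (s) lastv ps => [|a [|b s']] //=.
    by move=> E; rewrite E eqxx in uv.
  by move=> ->; rewrite (negbTE nuv).
have cc : ucycle e c.
  rewrite /ucycle uc andbT /c /= exu /= rcons_path ps /= lastv.
  by rewrite e_sym.
have [a [b [ac bc eab n1 n2]]] := e_chordal sz4 cc.
have nextE p1 a' b' p3 : u :: s = p1 ++ a' :: b' :: p3 -> next c a' = b'.
  move=> E; have a'c : a' \in c.
    by rewrite /c E inE mem_cat inE eqxx !orbT.
  rewrite next_nth a'c /c E /= ifN; last first.
    by apply: contraNneq xc => ->; rewrite E mem_cat inE eqxx orbT.
  rewrite index_cat /= eqxx addn0 ifN.
    by rewrite nth_cat ltnNge leqnSn /= subSnn.
  move: uc; rewrite /c E cons_uniq cat_uniq => /and4P [_ _ ha _].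
  by apply: contraNN ha => /= ->.
have nextx : next c x = u by rewrite /c /= eqxx.
have nextv : next c v = x.
  rewrite next_nth ifT; last first.
    by rewrite /c -lastv inE mem_last orbT.
  rewrite /c [index _ _]/= (negbTE xv) -[_.+1]/(index v (u :: s)).+1.
  by rewrite nth_default // -lastv index_last //; case/andP: uc.
have xcase b' : b' \in c -> e x b' -> b' = u \/ b' = v.
  rewrite inE => /orP [/eqP ->|/subH]; first by rewrite e_irr.
  rewrite !inE => /or3P [/eqP|/eqP|]; [by left|by right|].
  by move=> /Hx /negbTE ->.
(* By symmetry the chord starts at [x], and then it ends at [u] or [v], or it runs forward along the
   path. *)
wlog hab : a b ac bc eab n1 n2 / a = x \/ [/\ a != x, b != x &
    exists p1 p2 p3, u :: s = p1 ++ a :: p2 ++ b :: p3].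
  move=> W; have [ax|ax] := eqVneq a x; first by apply: (W a b) => //; left.
  have [bx|bx] := eqVneq b x.
    by apply: (W b a) => //; [rewrite e_sym|left].
  have split z r : z \in r -> exists p1 p2, r = p1 ++ z :: p2.
    by case/splitPr => p1 p2; exists p1, p2.
  have [p1 [p2 E]] : exists p1 p2, u :: s = p1 ++ a :: p2.
    by apply: split; move: ac; rewrite inE (negbTE ax).
  have : b \in u :: s by move: bc; rewrite inE (negbTE bx).
  rewrite E mem_cat inE; have [ba|_ /=] := eqVneq b a.
    by rewrite ba e_irr in eab.
  case/orP => /split [p3 [p4 E2]].
    apply: (W b a) => //; first by rewrite e_sym.
    by right; split => //; exists p3, p4, p2; rewrite E E2 -catA.
  apply: (W a b) => //; right; split => //.
  by exists p1, p3, p4; rewrite E E2.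
case: hab => [ax|[ax bx [p1 [p2 [p3 E]]]]].
  subst a; case: (xcase _ bc eab) => E; subst b.
    by rewrite nextx eqxx in n1.
  by rewrite nextv eqxx in n2.
have p20 := short _ _ _ _ _ E eab; rewrite p20 /= in E.
by rewrite (nextE _ _ _ _ E) eqxx in n1.
Qed.

(** Dirac's argument, by induction on [#|A|]. Let [H] be the component of the given [y] among the
    non-neighbours of [x], and [S] the vertices of [A] attached to [H] from outside. Then [S]
    consists of neighbours of [x], it is a clique by [chordal_path_edge], and [H :|: S] is smaller
    than [A] because it misses [x]. *)
Lemma nonadjacent_simplicial (A : {set T}) (x y : T) :
  x \in A -> y \in A -> y != x -> ~~ e x y ->
  exists z, [/\ z \in A, z != x, ~~ e x z & simplicial A z].
Proof.
have [k] := ubnP #|A|; elim: k A x y => // k IHk A x y0 /ltnSE leA xA yA yx exy.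
pose N := [set a in A | (a != x) && ~~ e x a].
pose e' := [rel a b | [&& e a b, a \in N & b \in N]].
have e'_sym : connect_sym e'.
  by apply: sym_connect_sym => a b /=; rewrite e_sym [X in _ && X]andbC.
pose H := [set h | connect e' y0 h].
have yN : y0 \in N by rewrite inE yA yx.
have y0H : y0 \in H by rewrite inE; apply: connect0.
have pathH a p : a \in H -> path e' a p -> {subset p <= H}.
  elim: p a => //= b p IHp a aH /andP [ab pp] z.
  have bH : b \in H.
    by move: aH; rewrite !inE => /connect_trans; apply; apply: connect1.
  by rewrite inE => /orP [/eqP ->//|]; apply: (IHp b).
have HN : {subset H <= N}.
  move=> h; rewrite inE => /connectP [p pp ->].
  elim: p (y0) yN pp => //= b p IHp a aN /andP [/and3P [_ _ bN]].
  exact: IHp.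
have HNP h : h \in H -> [/\ h \in A, h != x & ~~ e x h].
  by move/HN; rewrite inE => /and3P.
pose S := [set s in A | (s \notin H) && [exists h in H, e h s]].
have Sx s : s \in S -> [/\ s \in A, s \notin H, s != x & e x s].
  rewrite inE => /and3P [sA sH /exists_inP [h hH hs]].
  have [hA hx exh] := HNP _ hH.
  have sx : s != x by apply: contraNneq exh => <-; rewrite e_sym.
  split=> //; apply: contraNT sH => xs.
  move: (hH); rewrite !inE => /connect_trans; apply; apply: connect1 => /=.
  by rewrite hs (HN _ hH) inE sA sx.
have Scl u v : u \in S -> v \in S -> u != v -> e u v.
  move=> uS vS uv; have [uA uH ux xu] := Sx _ uS; have [vA vH vx xv] := Sx _ vS.
  move: uS vS; rewrite !inE => /and3P [_ _ /exists_inP [h1 h1H h1u]].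
  case/and3P => [_ _ /exists_inP [h2 h2H h2v]].
  have /connectP [p pp h2E] : connect e' h1 h2.
    have := h1H; rewrite inE e'_sym => /connect_trans; apply.
    by have := h2H; rewrite inE.
  apply: (@chordal_path_edge H x u v (h1 :: rcons p v)) => //; rewrite 1?eq_sym //.
  - by apply/negP => /HNP []; rewrite eqxx.
  - by move=> h /HNP [].
  - rewrite /= e_sym h1u rcons_path -h2E h2v andbT.
    by apply: sub_path pp => a b /and3P [].
  - by rewrite /= last_rcons.
  move=> z; rewrite !(inE, mem_rcons) => /or4P [->//|/eqP ->|->|]; rewrite ?orbT //.
    by move: h1H; rewrite inE => ->; rewrite !orbT.
  by move=> /(pathH _ _ h1H pp); rewrite inE => ->; rewrite !orbT.
pose A' := H :|: S.
have subA : A' \subset A.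
  by apply/fintype.subsetP => z; rewrite inE => /orP [/HNP []|/Sx []].
have ltA : (#|A'| < k)%N.
  apply: leq_trans leA; apply: proper_card; apply/properP; split=> //.
  by exists x => //; rewrite inE; apply/negP => /orP [/HNP []|/Sx []]; rewrite eqxx.
(* All neighbours in [A] of a vertex of [H] lie in [A'], so being simplicial there is enough. *)
suff [y yH ys] : exists2 y, y \in H & simplicial A' y.
  have [yA' yx' exy'] := HNP _ yH; exists y; split=> // a b aA bA eya eyb.
  have nb c : c \in A -> e y c -> c \in A'.
    move=> cA eyc; rewrite finset.in_setU; case cH: (c \in H) => //=.
    by rewrite inE cA cH /=; apply/exists_inP; exists y.
  by apply: ys => //; apply: nb.
(* The induction hypothesis gives a simplicial vertex not adjacent to a chosen one. If that one lies
   in [S], the new vertex is not in the clique [S]. Otherwise [S] is adjacent to everything and a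
   choice in [H] works; if none exists, [A'] is complete. *)
have [/exists_inP [s sS /exists_inP [z zA' /andP [zs esz]]]|/exists_inPn nS] :=
    boolP [exists s in S, [exists z in A', (z != s) && ~~ e s z]].
  have [] := IHk A' s z ltA _ zA' zs esz; first by rewrite inE sS orbT.
  move=> y [yA' ys esy simp]; exists y => //.
  move: yA'; rewrite finset.in_setU => /orP [//|yS].
  by rewrite Scl // eq_sym in esy.
have [/exists_inP [h hH /exists_inP [z zA' /andP [zh ehz]]]|/exists_inPn nH] :=
    boolP [exists h in H, [exists z in A', (z != h) && ~~ e h z]].
  have hA' : h \in A' by rewrite inE hH.
  have [] := IHk A' h z ltA hA' zA' zh ehz.
  move=> y [yA' yh ehy simp]; exists y => //.
  move: yA'; rewrite finset.in_setU => /orP [//|yS].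
  have /exists_inPn /(_ _ hA') := nS _ yS.
  by rewrite eq_sym yh e_sym ehy.
exists y0 => // a b aA' bA' _ _ ab.
move: (aA'); rewrite finset.in_setU => /orP [/nH|/nS] /exists_inPn /(_ _ bA');
  by rewrite eq_sym ab negbK.
Qed.

Lemma exists_simplicial (A : {set T}) (x : T) :
  x \in A -> exists2 y, y \in A & simplicial A y.
Proof.
move=> xA; have [/exists_inP [u uA /exists_inP [v vA /andP [vu euv]]]|] :=
    boolP [exists u in A, [exists v in A, (v != u) && ~~ e u v]].
  have [y [yA _ _ ys]] := nonadjacent_simplicial uA vA vu euv.
  by exists y.
move/exists_inPn => comp; exists x => // a b aA bA _ _ ab.
by have /exists_inPn /(_ _ bA) := comp _ aA; rewrite eq_sym ab negbK.
Qed.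

End Dirac.

(** * Sparse positive semidefinite matrices *)

Section SparsePSD.
Variables (R : realType) (m : nat).
Implicit Types (M : 'M[R]_m) (v : 'cV[R]_m).

Definition qform M v : R := (v^T *m M *m v) 0 0.

Lemma qformE M v : qform M v = \sum_i \sum_j v i 0 * M i j * v j 0.
Proof.
rewrite /qform mxE exchange_big; apply: eq_bigr => j _.
by rewrite mxE mulr_suml; apply: eq_bigr => i _; rewrite !mxE.
Qed.

Lemma qform_addZdelta M v i t : M^T = M ->
  qform M (v + t *: delta_mx i 0) =
    qform M v + t * (row i M *m v) 0 0 *+ 2 + t ^+ 2 * M i i.
Proof.
move=> sM; have cross : (v^T *m M *m (delta_mx i 0 : 'cV[R]_m)) 0 0 = (row i M *m v) 0 0.
  rewrite -colE mxE  [LHS]mxE [RHS]mxE; apply: eq_bigr => j _.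
  by rewrite !mxE mulrC (_ : M j i = M i j) // -{1}sM mxE.
have cross' : (((delta_mx i 0 : 'cV[R]_m))^T *m M *m v) 0 0 = (row i M *m v) 0 0.
  by rewrite trmx_delta -rowE.
have diagE : (((delta_mx i 0 : 'cV[R]_m))^T *m M *m (delta_mx i 0 : 'cV[R]_m)) 0 0 = M i i.
  by rewrite trmx_delta -rowE -colE !mxE.
rewrite /qform [(_ + _)^T]linearD /= [(_ *: _)^T]linearZ /= !mulmxDl !mulmxDr.
rewrite -!scalemxAl -!scalemxAr.
have addE (A B : 'M[R]_1) : (A + B) 0 0 = A 0 0 + B 0 0 by rewrite mxE.
have scaleE c (A : 'M[R]_1) : (c *: A) 0 0 = c * A 0 0 by rewrite mxE.
rewrite !addE !scaleE cross cross' diagE; ring.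
Qed.

Lemma qform_delta M i : qform M (delta_mx i 0) = M i i.
Proof. by rewrite /qform trmx_delta -rowE -colE !mxE. Qed.

(** Along coordinate [i] from the [j]-th unit vector the form is affine in [t]; unless [M i j = 0],
    some [t] makes it -1. *)
Lemma possemidef_diag0 M i j : possemidef M -> M i i = 0 -> M i j = 0.
Proof.
move=> [sM pM] Mii.
have h t : 0 <= M j j + t * M i j *+ 2.
  have := pM (delta_mx j 0 + t *: delta_mx i 0).
  rewrite -/(qform M _) qform_addZdelta // Mii mulr0 addr0.
  by rewrite qform_delta -colE !mxE.
apply/eqP; apply: contraT => nz.
have := h (- (M j j + 1) / (2 * M i j)).
rewrite (_ : _ + _ = -1); last by field; rewrite nz.
by rewrite ler0N1.
Qed.

(** The Schur complement kept at full size: for symmetric [M] with nonzero pivot, row and column [i]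
    become 0. With pivot 0 the inverse is 0 and [M] is unchanged. *)
Definition schur M i : 'M[R]_m := M - (M i i)^-1 *: ((row i M)^T *m row i M).

Lemma schurE M i a b : M^T = M ->
  schur M i a b = M a b - (M i i)^-1 * (M i a * M i b).
Proof. by move=> sM; rewrite !mxE big_ord1 !mxE. Qed.

(** Completing the square: for a nonzero pivot its form at [v] is the form of [M] at the minimizing
    point on the line through [v] in direction [i]. *)
Lemma schur_possemidef M i : possemidef M -> possemidef (schur M i).
Proof.
move=> PM; have [sM pM] := PM; split=> [|v].
  apply/matrixP => a b; rewrite mxE !schurE //.
  by rewrite -{1}sM mxE [M i b * _]mulrC.
have -> : (v^T *m schur M i *m v) 0 0 =
    qform M v - (M i i)^-1 * (row i M *m v) 0 0 ^+ 2.
  rewrite /schur mulmxBr mulmxBl -scalemxAr -scalemxAl.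
  have subZE c (A B : 'M[R]_1) : (A - c *: B) 0 0 = A 0 0 - c * B 0 0.
    by rewrite !mxE.
  rewrite subZE /qform.
  congr (_ - _ * _); rewrite mulmxA -trmx_mul -mulmxA; set w := row i M *m v.
  by rewrite mxE big_ord1 mxE expr2.
have [d0|d0] := eqVneq (M i i) 0; first by rewrite d0 invr0 mul0r subr0 pM.
have := pM (v + - ((M i i)^-1 * (row i M *m v) 0 0) *: delta_mx i 0).
rewrite -/(qform M _) qform_addZdelta //; congr (0 <= _).
by field.
Qed.

Variable e : rel 'I_m.
Hypotheses (e_sym : ssrbool.symmetric e) (e_irr : irreflexive e).
Hypothesis e_chordal : chordal e.

Definition sparse (A : nmodType) (M : 'M[A]_m) : Prop :=
  forall i j, i != j -> ~~ e i j -> M i j = 0.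

(** Induction on a set [A] containing all nonzero rows. A vertex [y] simplicial in [A] is
    eliminated: the support of row [y] is a clique, so subtracting its rank-one term creates no
    entry off the graph, and it clears row [y]. *)
Lemma rank1_clique_sum M : possemidef M -> sparse M ->
  exists2 vs : seq 'rV[R]_m,
    {in vs, forall v : 'rV[R]_m, clique e [set i | v 0 i != 0]} &
    M = \sum_(v <- vs) v^T *m v.
Proof.
move=> PM spM; have : {in ~: finset.setT, forall i j, M i j = 0}.
  by move=> i; rewrite !inE.
have [k] := ubnP #|[set: 'I_m]%SET|; move: [set: _]%SET => A.
elim: k A M PM spM => // k IHk A M PM spM /ltnSE leA A0.
have [sM pM] := PM; have sME a b : M a b = M b a by rewrite -{1}sM mxE.
have [AE|[x xA]] := set_0Vmem A.
  exists [::] => //; rewrite big_nil; apply/matrixP => i j.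
  by rewrite A0 ?mxE // AE !inE.
have [y yA ys] := exists_simplicial e_sym e_irr e_chordal xA.
have nzA a : M y a != 0 -> a \in A.
  by apply: contraNT => aA; rewrite sME A0 // inE.
have nze a : a != y -> M y a != 0 -> e y a.
  by move=> ay; apply: contraNT => nya; rewrite spM // eq_sym.
have cl a b : M y a != 0 -> M y b != 0 -> a != b -> e a b.
  have [->|ay] := eqVneq a y; first by move=> _ Mb yb; apply: nze; rewrite // eq_sym.
  have [->|ab] := eqVneq b y; first by move=> Ma _ _; rewrite e_sym nze.
  by move=> Ma Mb; apply: ys; rewrite ?nzA ?nze.
have d_ge0 : 0 <= M y y.
  have := pM (delta_mx y 0).
  by rewrite -/(qform M _) qform_delta.
have [||||vs vscl vsE] := IHk (A :\ y) (schur M y).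
- exact: schur_possemidef.
- move=> i j ij nij; rewrite schurE // spM // sub0r.
  have [->|Mi] := eqVneq (M y i) 0; first by rewrite mul0r mulr0 oppr0.
  have [->|Mj] := eqVneq (M y j) 0; first by rewrite !mulr0 oppr0.
  by rewrite cl in nij.
- by rewrite (leq_trans _ leA) // [leqRHS](cardsD1 y) yA.
- move=> i; rewrite !inE negb_and negbK => iA j; rewrite schurE //.
  have [iy|iy] := eqVneq i y.
    rewrite iy; have [d0|d0] := eqVneq (M y y) 0; last by rewrite mulKf ?subrr.
    by rewrite (possemidef_diag0 j PM d0) !mulr0 subrr.
  move: iA; rewrite (negbTE iy) /= => iA.
  have iA' : i \in ~: A by rewrite inE.
  by rewrite (A0 _ iA') [M y i]sME (A0 _ iA') mul0r mulr0 subrr.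
exists ((Num.sqrt (M y y))^-1 *: row y M :: vs).
  move=> v; rewrite inE => /orP [/eqP ->|]; last exact: vscl.
  apply/forall_inP => a; rewrite inE !mxE mulf_eq0 negb_or => /andP [_ Ma].
  apply/forall_inP => b; rewrite inE !mxE mulf_eq0 negb_or => /andP [_ Mb].
  by apply/implyP; apply: cl.
rewrite big_cons -vsE /schur [(_ *: _)^T]linearZ /= -scalemxAl -scalemxAr scalerA.
by rewrite -expr2 exprVn sqr_sqrtr // addrC subrK.
Qed.

Lemma clique_mxK (A : nzRingType) (D : {set 'I_m}) (v : 'rV[A]_m) :
  [set i | v 0 i != 0] \subset D ->
  v *m (clique_mx A D)^T *m clique_mx A D = v.
Proof.
move=> /fintype.subsetP vD; apply/rowP => j; rewrite mxE.
under eq_bigr => a _.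
  rewrite mxE (bigD1 (enum_val a)) //= big1 => [|i ia]; last first.
    by rewrite !mxE eq_sym (negbTE ia) mulr0.
  rewrite !mxE eqxx mulr1 addr0; over.
rewrite -(big_enum_val (fun x => v 0 x * (x == j)%:R)).
have [jD|jD] := boolP (j \in D).
  rewrite (bigD1 j) //= eqxx mulr1 big1 ?addr0 // => i /andP [_ /negbTE ->].
  by rewrite mulr0.
rewrite big1 => [|i iD]; last first.
  by case: eqVneq => [ij|]; rewrite ?mulr0 //; rewrite -ij iD in jD.
by apply/esym/eqP; apply: contraNT jD => vj; apply: vD; rewrite inE.
Qed.

(* A theorem of Agler, Helton, McCullough and Rodman. *)
Lemma clique_gram_sum (t : nat) (C : 'I_t -> {set 'I_m}) M :
  enumerates_maximal_cliques e C -> possemidef M -> sparse M ->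
  exists (h : nat) (H : forall k, 'M[R]_(h, #|C k|)),
    M = \sum_k (clique_mx R (C k))^T *m ((H k)^T *m H k) *m clique_mx R (C k).
Proof.
move=> [_ hC] PM spM; have [vs vscl ->] := rank1_clique_sum PM spM.
pose tv := in_tuple vs.
(* Each rank-one term is assigned to one maximal clique containing its support, so none is counted
   twice. *)
have /choice [kf kfP] (s : 'I_(size vs)) :
    exists k, [set i | tnth tv s 0 i != 0] \subset C k.
  have [D Dmax Dsub] := maxset_exists (vscl _ (mem_tnth s tv)).
  by have [k Ck] := (hC D).1 Dmax; exists k; rewrite Ck.
exists (size vs), (fun k => \matrix_(s < size vs)
  (if kf s == k then tnth tv s *m (clique_mx R (C k))^T else 0)).
pose E k := clique_mx R (C k).
have gram k : (E k)^T *m ((\matrix_(s < size vs)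
      (if kf s == k then tnth tv s *m (E k)^T else 0))^T *m
    (\matrix_(s < size vs) (if kf s == k then tnth tv s *m (E k)^T else 0))) *m E k
    = \sum_(s | kf s == k) (tnth tv s)^T *m tnth tv s.
  rewrite mulmxA -trmx_mul -mulmxA.
  set N := _ *m E k; have rowN s : row s N = (if kf s == k then tnth tv s else 0).
    rewrite row_mul rowK; case: eqP => [<-|]; last by rewrite mul0mx.
    by rewrite /E clique_mxK.
  have Ncol a s : N s a = (if kf s == k then tnth tv s else 0) 0 a.
    by rewrite -rowN [RHS]mxE.
  apply/matrixP => a b; rewrite mxE summxE [RHS]big_mkcond; apply: eq_bigr => s _.
  rewrite mxE !Ncol; case: ifP => _; last by rewrite !mxE mul0r.
  by rewrite mxE big_ord1 mxE.
rewrite [RHS](eq_bigr _ (fun k _ => gram k)) [LHS]big_tnth.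
by rewrite (partition_big kf xpredT (fun _ _ => isT)).
Qed.

End SparsePSD.

(** * Polya's theorem *)

Lemma exists_nat_ge (R : realType) (x : R) : exists k : nat, x <= k%:R.
Proof.
exists (Num.bound `|x|); apply: le_trans (ler_norm x) _.
by apply/ltW/archi_boundP.
Qed.

Section Polya.
Variables (R : realType) (M : nat).
Implicit Types (p : {mpoly R[M]}) (b : 'X_{1..M}).

Definition sumX : {mpoly R[M]} := \sum_(k < M) 'X_k.

(** The monomial as a word of variables, whose letters can be placed at positions of a longer
    word. *)
Definition mword b : seq 'I_M := flatten [seq nseq (b i) i | i <- enum 'I_M].

Lemma prod_mword (A : comNzRingType) (z : 'I_M -> A) b :
  \prod_(i <- mword b) z i = \prod_i z i ^+ b i.
Proof.
rewrite big_flatten big_map big_enum /=; apply: eq_bigr => i _.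
by rewrite big_nseq -Monoid.iteropE.
Qed.

Lemma size_mword b : size (mword b) = mdeg b.
Proof.
rewrite size_flatten /shape -map_comp sumnE big_map big_enum mdegE /=.
by apply: eq_bigr => i _; rewrite size_nseq.
Qed.

Definition freq N (w : {ffun 'I_N -> 'I_M}) : 'rV[R]_M :=
  \row_k (\sum_i (w i == k)%:R / N%:R).

Lemma freq_ge0 N (w : {ffun 'I_N -> 'I_M}) k : 0 <= freq w 0 k.
Proof. by rewrite mxE sumr_ge0 // => i _; rewrite divr_ge0. Qed.

Lemma sum_freq N (w : {ffun 'I_N -> 'I_M}) : (0 < N)%N -> \sum_k freq w 0 k = 1.
Proof.
move=> N0; under eq_bigr do rewrite mxE.
rewrite exchange_big /= (eq_bigr (fun=> N%:R^-1)) => [|i _].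
  by rewrite sumr_const card_ord -[LHS]mulr_natl mulfV // pnatr_eq0 -lt0n.
by rewrite -mulr_suml (bigD1 (w i)) //= eqxx big1 ?addr0 ?mul1r // => k /negbTE;
  rewrite eq_sym => ->.
Qed.

(** Expansion position by position: at position [f j] only the letter [v j] is kept, at the [N - D]
    free positions every letter is, since there the product in [F] is empty. *)
Lemma prod_ffun_expand D N (v : 'I_D -> 'I_M) (f : {ffun 'I_D -> 'I_N}) :
  injective f ->
  sumX ^+ (N - D) * \prod_j 'X_(v j) =
  \sum_(w : {ffun 'I_N -> 'I_M})
    (\prod_j (w (f j) == v j)%:R) *: \prod_i 'X_(w i).
Proof.
move=> f_inj.
pose F i k : {mpoly R[M]} := (\prod_(j | f j == i) (k == v j)%:R) *: 'X_k.
transitivity (\prod_i \sum_k F i k); last first.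
  rewrite bigA_distr_bigA; apply: eq_bigr => w _.
  rewrite /F scaler_prod; congr (_ *: _).
  rewrite (partition_big f xpredT (fun _ _ => isT)) /=.
  by apply: eq_bigr => i _; apply: eq_bigr => j /eqP ->.
rewrite (bigID (mem (f @: [set: 'I_D]%SET))) /= mulrC; congr (_ * _).
  rewrite big_imset /=; last by move=> ? ? _ _; apply: f_inj.
  rewrite [RHS](eq_bigl xpredT); last by move=> j; rewrite inE.
  apply: eq_bigr => j _; rewrite (bigD1 (v j)) //= big1 => [|k /negbTE kv].
    rewrite addr0 /F (big_pred1 j) ?eqxx ?scale1r // => j'.
    by rewrite (inj_eq f_inj).
  by rewrite /F (big_pred1 j) ?kv ?scale0r // => j'; rewrite (inj_eq f_inj).
rewrite (eq_bigr (fun=> sumX)) => [|i ni]; last first.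
  apply: eq_bigr => k _; rewrite /F big_pred0 ?scale1r // => j.
  by apply: contraNF ni => /eqP <-; rewrite imset_f.
rewrite prodr_const; congr (_ ^+ _).
have cS : #|f @: [set: 'I_D]%SET| = D by rewrite card_imset // cardsT card_ord.
have := cardC (mem (f @: [set: 'I_D]%SET)); rewrite cS card_ord => NE.
by rewrite -[X in (X - _)%N]NE addKn.
Qed.

(** Without injectivity the letters are placed independently, so the sum factors. *)
Lemma prod_ffun_freq D N (v : 'I_D -> 'I_M) (w : {ffun 'I_N -> 'I_M}) :
  (0 < N)%N ->
  \sum_(f : {ffun 'I_D -> 'I_N}) \prod_j (w (f j) == v j)%:R =
  N%:R ^+ D * \prod_j freq w 0 (v j).
Proof.
move=> N0; rewrite -(bigA_distr_bigA (fun j i => (w i == v j)%:R : R)).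
rewrite -[D in _ ^+ D]card_ord -prodr_const -big_split; apply: eq_bigr => j _.
by rewrite /= mxE -mulr_suml [RHS]mulrC divfK // pnatr_eq0 -lt0n.
Qed.

(* (sum_k u_k)^N expands over the words w of length N.  Placing the factors of a
   monomial b at distinct positions of w and averaging over all placements gives
   a coefficient close to the value of b at the letter frequencies of w, which is
   the same average over placements that need not be injective. *)
Definition bern_mon N b (w : {ffun 'I_N -> 'I_M}) : R :=
  (N ^_ size (mword b))%:R^-1 *
  \sum_(f : {ffun 'I_(size (mword b)) -> 'I_N} | injectiveb f)
    \prod_j (w (f j) == tnth (in_tuple (mword b)) j)%:R.

(** This is [prod_ffun_expand] averaged over all injective placements, on which its left side does
    not depend. *)
Lemma bern_monE N b : (mdeg b <= N)%N ->
  sumX ^+ (N - mdeg b) * 'X_[b] =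
  \sum_(w : {ffun 'I_N -> 'I_M}) bern_mon b w *: \prod_i 'X_(w i).
Proof.
rewrite -size_mword mpolyXE_id => bN; pose v := tnth (in_tuple (mword b)).
under [RHS]eq_bigr => w _ do rewrite /bern_mon -scalerA scaler_suml.
rewrite -scaler_sumr exchange_big /=.
rewrite [X in _ *: X](eq_bigr (fun=> sumX ^+ (N - size (mword b)) * \prod_j 'X_(v j))).
  rewrite sumr_const -prod_mword big_tnth -[X in _ *: X]scaler_nat scalerA.
  set c := #|_|; suff -> : c = (N ^_ size (mword b))%N.
    by rewrite mulVf ?scale1r // pnatr_eq0 -lt0n ffact_gt0.
  rewrite -[N in RHS]card_ord -[X in _ ^_ X]card_ord -card_inj_ffuns.
  by apply: eq_card => f; rewrite inE.
by move=> f /injectiveP finj; rewrite (prod_ffun_expand v finj).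
Qed.

(** The ratio is the proportion of injective maps among all maps from [D] points to [N]; passing to
    [D.+1] multiplies it by 1 - D/N. *)
Lemma ffact_ratio N D : (D <= N)%N -> (0 < N)%N ->
  1 - (D ^ 2)%:R / N%:R <= (N ^_ D)%:R / N%:R ^+ D :> R.
Proof.
move=> DN N0; have Np : 0 < N%:R :> R by rewrite ltr0n.
elim: D DN => [|D IHD] DN.
  by rewrite ffactn0 expr0 divr1 mul0r subr0.
have {}IHD := IHD (ltnW DN).
rewrite ffactnSr natrM natrB ?(ltnW DN) // exprSr.
rewrite [leRHS](_ : _ = ((N ^_ D)%:R / N%:R ^+ D) * (1 - D%:R / N%:R)); last first.
  have : N%:R ^+ D != 0 :> R by rewrite gt_eqF ?exprn_gt0.
  by move: (N%:R ^+ D) => P P0; field; rewrite P0 gt_eqF.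
have dN : 0 <= 1 - D%:R / N%:R :> R.
  by rewrite subr_ge0 ler_pdivrMr // mul1r ler_nat ltnW.
apply: le_trans (ler_wpM2r dN IHD).
have u0 : 0 <= D%:R / N%:R :> R by rewrite divr_ge0.
rewrite !natrX -[D.+1]addn1 natrD.
rewrite (_ : (D%:R + 1) ^+ 2 / N%:R = D%:R ^+ 2 / N%:R + (D%:R / N%:R) *+ 2 + N%:R^-1); last by ring.
have : 0 <= (D%:R ^+ 2 / N%:R) * (D%:R / N%:R) :> R.
  by rewrite mulr_ge0 // divr_ge0 // exprn_ge0.
have : 0 <= N%:R^-1 :> R by rewrite invr_ge0 ltW.
move: u0; set a := _ / _; set c := _ / _; set d := _^-1; lra.
Qed.

Lemma bern_mon_approx N b (w : {ffun 'I_N -> 'I_M}) :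
  (mdeg b <= N)%N -> (0 < N)%N ->
  `|bern_mon b w - \prod_i freq w 0 i ^+ b i| <= (mdeg b ^ 2)%:R / N%:R.
Proof.
rewrite -size_mword => bN N0; pose v := tnth (in_tuple (mword b)).
set D := size (mword b) in v bN *.
pose term (f : {ffun 'I_D -> 'I_N}) : R := \prod_j (w (f j) == v j)%:R.
have t01 f : 0 <= term f <= 1.
  rewrite /term prodr_ge0 //=; apply: prodr_ile1 => j _.
  by rewrite ler0n lern1 leq_b1.
have Np : 0 < N%:R ^+ D :> R by rewrite exprn_gt0 // ltr0n.
have Fp : 0 < (N ^_ D)%:R :> R by rewrite ltr0n ffact_gt0.
have -> : \prod_i freq w 0 i ^+ b i = (N%:R ^+ D)^-1 * \sum_f term f.
  rewrite prod_ffun_freq // mulKf ?gt_eqF //.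
  by rewrite -(prod_mword (fun i => freq w 0 i)) big_tnth.
have -> : bern_mon b w = (N ^_ D)%:R^-1 * \sum_(f : {ffun 'I_D -> 'I_N} | injectiveb f) term f by [].
rewrite (bigID (fun f : {ffun 'I_D -> 'I_N} => injectiveb f) xpredT term) /=.
set A := \sum_(f : {ffun 'I_D -> 'I_N} | injectiveb f) _.
set B := \sum_(f : {ffun 'I_D -> 'I_N} | ~~ injectiveb f) _.
have cA : #|[pred f : {ffun 'I_D -> 'I_N} | injectiveb f]| = (N ^_ D)%N.
  rewrite -[N in RHS]card_ord -[X in _ ^_ X]card_ord -card_inj_ffuns.
  by apply: eq_card => f; rewrite !inE.
have cB : #|[pred f : {ffun 'I_D -> 'I_N} | ~~ injectiveb f]| = (N ^ D - N ^_ D)%N.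
  have := cardC [pred f : {ffun 'I_D -> 'I_N} | injectiveb f].
  by rewrite cA card_ffun !card_ord => <-; rewrite addKn.
have A0 : 0 <= A by apply: sumr_ge0 => f _; case/andP: (t01 f).
have B0 : 0 <= B by apply: sumr_ge0 => f _; case/andP: (t01 f).
have A1 : A <= (N ^_ D)%:R.
  rewrite -cA -sumr_const; apply: ler_sum => f _; by case/andP: (t01 f).
have FN : (N ^_ D <= N ^ D)%N.
  have := max_card [pred f : {ffun 'I_D -> 'I_N} | injectiveb f].
  by rewrite cA card_ffun !card_ord.
have B1 : B <= N%:R ^+ D - (N ^_ D)%:R.
  rewrite -natrX -natrB // -cB -sumr_const.
  by apply: ler_sum => f _; case/andP: (t01 f).
have := ffact_ratio bN N0; set r := _ / N%:R => hr.
have hA : A / (N ^_ D)%:R <= 1 by rewrite ler_pdivrMr // mul1r.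
have hA0 : 0 <= A / (N ^_ D)%:R by rewrite divr_ge0 // ltW.
have hB : B / N%:R ^+ D <= 1 - (N ^_ D)%:R / N%:R ^+ D.
  by rewrite ler_pdivrMr // mulrBl mul1r divfK // gt_eqF.
have hB0 : 0 <= B / N%:R ^+ D by rewrite divr_ge0 // ltW.
have hF : (N ^_ D)%:R / N%:R ^+ D <= 1 :> R.
  by rewrite ler_pdivrMr // mul1r -natrX ler_nat.
(* [A] collects the injective placements, [B] the others. Both terms of this difference lie between
   0 and the proportion of non-injective placements. *)
have -> : (N ^_ D)%:R^-1 * A - (N%:R ^+ D)^-1 * (A + B) =
   (A / (N ^_ D)%:R) * (1 - (N ^_ D)%:R / N%:R ^+ D) - B / N%:R ^+ D.
  by field; rewrite !gt_eqF.
move: hr hA hA0 hB hB0 hF.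
set x := A / _; set y := _ / N%:R ^+ D; set z := B / _ => hr hA hA0 hB hB0 hF.
by rewrite ler_norml; apply/andP; split; nra.
Qed.

Definition bern N p (w : {ffun 'I_N -> 'I_M}) : R :=
  \sum_(b <- msupp p) p@_b * bern_mon b w.

Lemma bern0 N (w : {ffun 'I_N -> 'I_M}) : bern 0 w = 0.
Proof. by rewrite /bern msupp0 big_nil. Qed.

Lemma bernE N D p : p \is D.-homog -> (D <= N)%N ->
  sumX ^+ (N - D) * p =
  \sum_(w : {ffun 'I_N -> 'I_M}) bern p w *: \prod_i 'X_(w i).
Proof.
move=> /dhomogP hp DN; rewrite {1}[p]mpolyE mulr_sumr.
under [RHS]eq_bigr do rewrite scaler_suml.
rewrite [RHS]exchange_big /=; apply: eq_big_seq => b /hp db.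
rewrite -scalerAr -db bern_monE ?db // scaler_sumr.
by apply: eq_bigr => w _; rewrite scalerA.
Qed.

(** The error is at most the sum of the absolute coefficients times D^2/N, uniformly in the word
    [w]. *)
Lemma bern_approx D p (eps : R) : p \is D.-homog -> 0 < eps ->
  exists N0, forall N (w : {ffun 'I_N -> 'I_M}), (N0 <= N)%N ->
    `|bern p w - p.@[fun i => freq w 0 i]| <= eps.
Proof.
move=> /dhomogP hp eps0; pose S := \sum_(b <- msupp p) `|p@_b|.
have S0 : 0 <= S by apply: sumr_ge0.
have [K hK] : exists K : nat, S * (D ^ 2)%:R / eps <= K%:R.
  exact: exists_nat_ge.
exists (maxn 1 (maxn D K)) => N w; rewrite !geq_max => /and3P [N0 DN KN].
rewrite /bern mevalE -sumrB.
under eq_bigr do rewrite -mulrBr.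
apply: le_trans (ler_norm_sum _ _ _) _.
apply: (@le_trans _ _ (S * ((D ^ 2)%:R / N%:R))).
  rewrite mulr_suml big_seq [leRHS]big_seq; apply: ler_sum => b /hp db.
  rewrite normrM; apply: ler_wpM2l => //.
  by rewrite -db bern_mon_approx ?db.
rewrite mulrA ler_pdivrMr ?ltr0n // [leRHS]mulrC -ler_pdivrMr //.
by apply: le_trans hK _; rewrite ler_nat.
Qed.

End Polya.

(** * Positivity on compact sets *)

Section CompactPositivity.
Variable R : realType.
Local Open Scope classical_set_scope.

(** For 0 <= t <= 1, (n+1) t (1-t)^n + (1-t)^(n+1) is the probability of at most one success in n+1
    trials, hence at most 1. For [t <= 0] the left side is not positive. *)
Lemma mul_expr_1B_le (t : R) n : t <= 1 -> t * (1 - t) ^+ n <= n.+1%:R^-1.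
Proof.
move=> t1; have s0 : 0 <= 1 - t by rewrite subr_ge0.
have [t0|t0] := lerP t 0.
  apply: (@le_trans _ _ 0); last by rewrite invr_ge0.
  by rewrite mulr_le0_ge0 // exprn_ge0.
have s1 : 1 - t <= 1 by lra.
suff h : n.+1%:R * (t * (1 - t) ^+ n) + (1 - t) ^+ n.+1 <= 1.
  rewrite -[leRHS]mul1r ler_pdivlMr // mulrC.
  by apply: le_trans h; rewrite lerDl exprn_ge0.
elim: n => [|n IHn]; first by rewrite expr0 expr1; lra.
have p0 : 0 <= (1 - t) ^+ n.+1 by rewrite exprn_ge0.
have p1 : (1 - t) ^+ n.+1 <= 1 by rewrite exprn_ile1.
have h1 := ler_wpM2l s0 IHn; have h2 := ler_wpM2l (ltW t0) p1.
have -> : n.+2%:R = n.+1%:R + 1 :> R by rewrite -[n.+2]addn1 natrD.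
move: h1 h2; rewrite !exprS; move: ((1 - t) ^+ n) (n.+1%:R : R) => P N; lra.
Qed.

Lemma bernoulli_le (a : R) n : 0 <= a -> 1 + n%:R * a <= (1 + a) ^+ n.
Proof.
move=> a0; elim: n => [|n IHn]; first by rewrite mul0r addr0 expr0.
have a1 : 0 <= 1 + a by lra.
have n0 : 0 <= n%:R * a * a by rewrite !mulr_ge0.
rewrite exprS; apply: le_trans (ler_wpM2l a1 IHn).
by rewrite -addn1 natrD; nra.
Qed.

Lemma cont_sum (T : topologicalType) (J : Type) (r : seq J) (g : J -> T -> R) :
  (forall j, continuous (g j)) -> continuous (fun x => \sum_(j <- r) g j x).
Proof.
move=> cg x; elim: r => [|j r IHr].
  under eq_fun do rewrite big_nil; exact: cvg_cst.
under eq_fun do rewrite big_cons.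
by apply: cvgD => //; apply: cg.
Qed.

Lemma compact_bound (T : topologicalType) (K : set T) (f : T -> R) :
  compact K -> continuous f -> exists2 B, 0 < B & forall x, K x -> `|f x| <= B.
Proof.
move=> cK cf; have [->|/set0P K0] := eqVneq K classical_sets.set0.
  by exists 1.
have cnf : {within K, continuous (fun x => `|f x|)}.
  by apply: continuous_subspaceT => x; apply: cvg_norm; apply: cf.
have [c cin cmax] := compact_EVT_max K0 cK cnf.
exists (1 + `|f c|) => [|x Kx]; first by rewrite ltr_pwDl.
by apply: le_trans (cmax x _) _; [exact: mem_set|rewrite lerDr].
Qed.

(** Once |c g| <= 1 on [K], a correction term is at most of order 1/k, while where g <= -eta it is
    at most -eta (1 + c eta)^(2k), which outweighs any bound on [f] for large k. *)
Lemma compact_positivity (T : topologicalType) (J : finType) (K : set T)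
    (f : T -> R) (g : J -> T -> R) :
  compact K -> continuous f -> (forall j, continuous (g j)) ->
  (forall x, K x -> (forall j, 0 <= g j x) -> 0 < f x) ->
  exists (c : R) (k : nat) (d : R), [/\ 0 < c, 0 < d & forall x, K x ->
    d <= f x - \sum_j g j x * (1 - c * g j x) ^+ (2 * k)%N].
Proof.
move=> cK cf cg fpos; have [->|/set0P K0] := eqVneq K classical_sets.set0.
  by exists 1, 0%N, 1.
have [F F0 fF] := compact_bound cK cf.
have [G G0 gG] : exists2 G, 0 < G & forall x, K x -> forall j, `|g j x| <= G.
  have cS : continuous (fun x => \sum_j `|g j x|).
    by apply: cont_sum => j x; apply: cvg_norm; apply: cg.
  have [G G0 gG] := compact_bound cK cS.
  exists G => // x Kx j; apply: le_trans (le_trans (ler_norm _) (gG x Kx)).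
  by rewrite (bigD1 j) //= lerDl sumr_ge0.
(* [h] is nonnegative and vanishes only where f <= 0 and all g >= 0, so it has a positive minimum on
   [K]. *)
pose h x := (f x + `|f x|) + \sum_j (`|g j x| - g j x).
have ch : {within K, continuous h}.
  apply: continuous_subspaceT => x; apply: cvgD.
    by apply: cvgD; [exact: cf|apply: cvg_norm; exact: cf].
  apply: (@cont_sum _ _ _ (fun j x => `|g j x| - g j x)) => j y.
  by apply: cvgB; [apply: cvg_norm|]; exact: cg.
have [x0 Kx0 hmin] := compact_EVT_min K0 cK ch.
have h0 : 0 < h x0.
  have gj0 j : 0 <= `|g j x0| - g j x0 by rewrite subr_ge0 ler_norm.
  have S0 : 0 <= \sum_j (`|g j x0| - g j x0) by apply: sumr_ge0.
  have f0 : 0 <= f x0 + `|f x0| by rewrite -lerBlDl sub0r -normrN ler_norm.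
  have [/forallP gpos|/forallPn [j]] := boolP [forall j, 0 <= g j x0].
    apply: ltr_wpDr => //; have := fpos _ (set_mem Kx0) gpos.
    by move=> fp; rewrite ltr_wpDr.
  rewrite -ltNge => gneg; rewrite ltr_wpDl // (bigD1 j) //= ltr_wpDr //.
    exact: sumr_ge0.
  by rewrite ltr0_norm //; lra.
pose N : R := #|J|%:R; have N0 : 0 <= N by [].
(* If [f x < eta] and every [g j x] exceeded [- eta], then [h x] would be below 2 eta (N + 1), which
   is the minimum. *)
pose eta := h x0 / (2 * (N + 1)).
have eta0 : 0 < eta by rewrite divr_gt0 // mulr_gt0 // ltr_wpDl.
have alt x : K x -> eta <= f x \/ exists j, g j x <= - eta.
  move=> Kx; have [|fx] := lerP eta (f x); [by left|right].
  apply: contrapT => /forallNP gx.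
  have {}gx j : - eta < g j x by rewrite ltNge; apply/negP.
  have := hmin x (mem_set Kx); rewrite leNgt => /negP; apply.
  have -> : h x0 = eta *+ 2 + \sum_(j : J) eta *+ 2.
    have N1 : N + 1 != 0 by rewrite gt_eqF // ltr_wpDl.
    rewrite sumr_const -[_ *+ #|_|]mulr_natr -/N /eta.
    have aux (a r : R) : r + 1 != 0 ->
        a = a / (2 * (r + 1)) *+ 2 + a / (2 * (r + 1)) *+ 2 * r.
      by move=> r1; field.
    exact: aux.
  apply: ltr_leD.
    by have [f0|f0] := ler0P (f x); lra.
  apply: ler_sum => j _; have := gx j; have [g0|g0] := ler0P (g j x); lra.
pose c := G^-1; have c0 : 0 < c by rewrite invr_gt0.
(* The first summand keeps the total of the positive corrections below [eta / 2]; the second makes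
   Bernoulli's inequality beat the lower bound -F of [f]. *)
have [k hk] : exists k : nat, N * G / eta + F / (c * eta ^+ 2) <= k%:R.
  exact: exists_nat_ge.
exists c, k, (eta / 2); split=> //; first by rewrite divr_gt0.
have etaW := ltW eta0; have GW := ltW G0; have cW := ltW c0.
have NG0 : 0 <= N * G / eta by apply: divr_ge0 => //; apply: mulr_ge0.
have Fc0 : 0 <= F / (c * eta ^+ 2).
  apply: divr_ge0; first exact: ltW.
  by apply: mulr_ge0 => //; apply: exprn_ge0.
pose u := G / (2 * k)%N.+1%:R; have u0 : 0 <= u by apply: divr_ge0.
have Nu : N * u <= eta / 2.
  have e2 : 0 < eta / 2 by apply: divr_gt0.
  rewrite mulrA ler_pdivrMr // -ler_pdivrMl //.
  rewrite invf_div mulrC (_ : _ * (2 / eta) = 2 * (N * G / eta)); last by ring.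
  have -> : (2 * k)%N.+1%:R = 2 * k%:R + 1 :> R by rewrite -natr1 natrM.
  by move: NG0 Fc0 hk; lra.
have term x j : K x -> g j x * (1 - c * g j x) ^+ (2 * k)%N <= u.
  move=> Kx; have t1 : c * g j x <= 1.
    rewrite mulrC ler_pdivrMr // mul1r.
    exact: le_trans (ler_norm _) (gG _ Kx j).
  have := mul_expr_1B_le (2 * k)%N t1; rewrite -(ler_pM2l G0) mulrA.
  by rewrite [G * _]mulrA mulfV ?gt_eqF // mul1r.
move=> x Kx; have [fx|[j gx]] := alt x Kx.
  have : \sum_j g j x * (1 - c * g j x) ^+ (2 * k)%N <= N * u.
    by rewrite mulr_natl -sumr_const; apply: ler_sum => j _; exact: term.
  by move: Nu fx; lra.
have rest : \sum_(i | i != j) g i x * (1 - c * g i x) ^+ (2 * k)%N <= N * u.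
  apply: (@le_trans _ _ (\sum_(i | i != j) u)).
    by apply: ler_sum => i _; exact: term.
  rewrite mulr_natl -sumr_const [leRHS](bigD1 j) //=.
  by rewrite lerDr.
have ce0 : 0 <= c * eta by apply: mulr_ge0.
have big : F + eta <= - g j x * (1 - c * g j x) ^+ (2 * k)%N.
  apply: (@le_trans _ _ (eta * (1 + (2 * k)%N%:R * (c * eta)))).
    have : F <= k%:R * (c * eta ^+ 2).
      rewrite -ler_pdivrMr; last by rewrite mulr_gt0 // exprn_gt0.
      by apply: le_trans hk; rewrite lerDr.
    have F2 : 0 <= k%:R * (c * eta ^+ 2).
      by do 2?apply: mulr_ge0 => //; apply: exprn_ge0.
    rewrite natrM mulrDr mulr1 (_ : eta * (2 * _ * _) = 2 * (k%:R * (c * eta ^+ 2))); last by ring.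
    by move: F2; lra.
  have gx' : eta <= - g j x by lra.
  apply: ler_pM => //.
    by rewrite addr_ge0 // mulr_ge0.
  apply: le_trans (bernoulli_le _ ce0) _.
  apply: lerXn2r; rewrite ?nnegrE; try lra.
    by have := ler_wpM2l (ltW c0) gx'; move: ce0; lra.
  by have := ler_wpM2l (ltW c0) gx'; lra.
rewrite (bigD1 j) //=.
have := fF x Kx; rewrite ler_norml => /andP [fl _].
move: rest big Nu fl eta0; lra.
Qed.

End CompactPositivity.

(** * Lifting to the simplex *)

Section Lifting.
Variables (R : realType) (n : nat).

(** The index (i, j, s) stands for the square of z_i + (-1)^s z_j, where z = (1, x). *)
Let idx := ('I_n.+1 * 'I_n.+1 * bool)%type.
Definition dimU := #|{: idx}|.
Definition ucode (a : idx) : 'I_dimU := enum_rank a.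
Definition udecode (k : 'I_dimU) : idx := enum_val k.

Lemma ucodeK : cancel ucode udecode.
Proof. exact: enum_rankK. Qed.

Lemma udecodeK : cancel udecode ucode.
Proof. exact: enum_valK. Qed.

Definition hcoord (i : 'I_n.+1) : {mpoly R[n]} :=
  if unlift ord0 i is Some k then 'X_k else 1.

(** The squares of z_i + z_j and z_i - z_j add up over all i, j to 4 (n+1) |z|^2, whence the scaling
    factor. *)
Definition uroot (k : 'I_dimU) : {mpoly R[n]} :=
  let: (i, j, s) := udecode k in
  Num.sqrt (4 * n.+1%:R)^-1 *: (hcoord i + (-1) ^+ s *: hcoord j).

Definition usq : dimU.-tuple {mpoly R[n]} := [tuple uroot k ^+ 2 | k < dimU].

(** Entry (i, j) of Y(u), by polarization: the two squares differ by 4 z_i z_j. *)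
Definition ymon (i j : 'I_n.+1) : {mpoly R[dimU]} :=
  n.+1%:R *: ('X_(ucode (i, j, false))
              - 'X_(ucode (i, j, true))).

Lemma usqE i j s : 'X_(ucode (i, j, s)) \mPo usq =
  (4 * n.+1%:R)^-1 *: (hcoord i + (-1) ^+ s *: hcoord j) ^+ 2.
Proof.
rewrite comp_mpolyXU -tnth_nth tnth_mktuple /uroot ucodeK exprZn.
by rewrite sqr_sqrtr // invr_ge0 mulr_ge0.
Qed.

Lemma sumX_comp : sumX R dimU \mPo usq = one_plus_normsq R n.
Proof.
rewrite /sumX raddf_sum /=.
rewrite (reindex ucode); last by apply: onW_bij; exists udecode;
  [exact: ucodeK|exact: udecodeK].
transitivity (\sum_i \sum_j \sum_s ('X_(ucode (i, j, s)) \mPo usq)).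
  by rewrite pair_bigA pair_bigA; apply: eq_bigr => -[[]].
pose S : {mpoly R[n]} := \sum_i hcoord i ^+ 2.
have SE : S = one_plus_normsq R n.
  rewrite /S big_ord_recl /hcoord unlift_none expr1n /one_plus_normsq.
  by congr (_ + _); apply: eq_bigr => i _; rewrite liftK.
rewrite -SE; transitivity (\sum_i \sum_j (4 * n.+1%:R)^-1 *:
    ((hcoord i ^+ 2 + hcoord j ^+ 2) *+ 2)).
  apply: eq_bigr => i _; apply: eq_bigr => j _.
  rewrite big_bool !usqE /= -scalerDr expr1 expr0 scale1r scaleN1r.
  by congr (_ *: _); ring.
under eq_bigr do rewrite -scaler_sumr sumrMnl big_split /= sumr_const card_ord -/S.
rewrite -scaler_sumr sumrMnl big_split /= sumr_const card_ord sumrMnl -/S.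
rewrite -mulr2n -!mulrnA -[S *+ _]scaler_nat scalerA -[RHS]scale1r.
by congr (_ *: _); rewrite !natrM; field.
Qed.

Lemma ymon_comp i j : ymon i j \mPo usq = hcoord i * hcoord j.
Proof.
rewrite /ymon comp_mpolyZ comp_mpolyB !usqE expr0 expr1 scale1r scaleN1r.
rewrite -scalerBr scalerA (_ : _ - _ = 4%:R *: (hcoord i * hcoord j)).
  by rewrite scalerA -[RHS]scale1r; congr (_ *: _); field.
by rewrite scaler_nat; ring.
Qed.

Lemma ymon_homog i j : ymon i j \is 1.-homog.
Proof. by rewrite rpredZ // rpredB // dhomogX /= mdeg1. Qed.

Fixpoint yprod (s : seq 'I_n.+1) : {mpoly R[dimU]} :=
  if s is a :: b :: s' then ymon a b * yprod s' else 1.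

Lemma yprod_homog D s : size s = D.*2 -> yprod s \is D.-homog.
Proof.
elim: D s => [|D IHD] [|a [|b s]] //=; first by move=> _; exact: dhomog1.
by case=> sz; rewrite -add1n dhomogM ?ymon_homog // IHD.
Qed.

(** Stated for a general morphism because it serves both the substitution of [usq] and the
    evaluation at a point where Y has the form z z^T. *)
Lemma yprod_morph (A : comNzRingType) (psi : {rmorphism {mpoly R[dimU]} -> A})
    (z : 'I_n.+1 -> A) D s :
  (forall i j, psi (ymon i j) = z i * z j) -> size s = D.*2 ->
  psi (yprod s) = \prod_(a <- s) z a.
Proof.
move=> hz; elim: D s => [|D IHD] [|a [|b s]] //=.
  by rewrite rmorph1 big_nil.
by case=> sz; rewrite rmorphM hz IHD // !big_cons mulrA.
Qed.

(** Padding with the coordinate z_0 homogenizes the monomial to degree [2 * D]; the even length lets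
    [yprod] pair the letters. *)
Definition hword D (b : 'X_{1..n}) : seq 'I_n.+1 :=
  nseq (2 * D - mdeg b) ord0 ++ map (lift ord0) (mword b).

Lemma size_hword D b : (mdeg b <= 2 * D)%N -> size (hword D b) = D.*2.
Proof.
by move=> db; rewrite size_cat size_nseq size_map size_mword subnK // mul2n.
Qed.

Lemma prod_hword (A : comNzRingType) (z : 'I_n.+1 -> A) D b :
  \prod_(a <- hword D b) z a =
  z ord0 ^+ (2 * D - mdeg b) * \prod_i z (lift ord0 i) ^+ b i.
Proof.
rewrite big_cat big_map /= (prod_mword (fun i => z (lift ord0 i))).
by rewrite big_nseq -Monoid.iteropE.
Qed.

Definition ylift D (p : {mpoly R[n]}) : {mpoly R[dimU]} :=
  \sum_(b <- msupp p) p@_b *: yprod (hword D b).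

Definition heval D (p : {mpoly R[n]}) (z : 'I_n.+1 -> R) : R :=
  \sum_(b <- msupp p)
    p@_b * (z ord0 ^+ (2 * D - mdeg b) * \prod_i z (lift ord0 i) ^+ b i).

Lemma ylift0 D : ylift D 0 = 0.
Proof. by rewrite /ylift msupp0 big_nil. Qed.

Lemma msupp_mdeg_le D (p : {mpoly R[n]}) b :
  (msize p <= (2 * D).+1)%N -> b \in msupp p -> (mdeg b <= 2 * D)%N.
Proof. by move=> pD /msize_mdeg_lt bp; rewrite -ltnS (leq_trans bp). Qed.

Lemma ylift_homog D p : (msize p <= (2 * D).+1)%N -> ylift D p \is D.-homog.
Proof.
move=> pD; rewrite /ylift big_seq rpred_sum // => b bp.
by rewrite rpredZ // yprod_homog // size_hword // (msupp_mdeg_le pD).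
Qed.

Lemma ylift_comp D p : (msize p <= (2 * D).+1)%N -> ylift D p \mPo usq = p.
Proof.
move=> pD; rewrite [RHS]mpolyE /ylift raddf_sum /=; apply: eq_big_seq => b bp.
have sz := size_hword (msupp_mdeg_le pD bp).
rewrite comp_mpolyZ; congr (_ *: _).
rewrite (yprod_morph (psi := comp_mpoly usq) ymon_comp sz).
rewrite prod_hword /hcoord unlift_none expr1n mul1r mpolyXE_id.
by apply: eq_bigr => i _; rewrite liftK.
Qed.

Lemma ylift_eval D p (th : 'I_dimU -> R) (z : 'I_n.+1 -> R) :
  (msize p <= (2 * D).+1)%N ->
  (forall i j, (ymon i j).@[th] = z i * z j) -> (ylift D p).@[th] = heval D p z.
Proof.
move=> pD hz; rewrite /ylift raddf_sum /=; apply: eq_big_seq => b bp.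
have sz := size_hword (msupp_mdeg_le pD bp).
by rewrite mevalZ (yprod_morph (psi := meval th) hz sz) prod_hword.
Qed.

Lemma heval_affine D p z : (msize p <= (2 * D).+1)%N -> z ord0 != 0 ->
  heval D p z = z ord0 ^+ (2 * D) * p.@[fun i => z (lift ord0 i) / z ord0].
Proof.
move=> pD z0; rewrite /heval mevalE mulr_sumr; apply: eq_big_seq => b bp.
have db := msupp_mdeg_le pD bp; rewrite [RHS]mulrCA; congr (_ * _).
under [in RHS]eq_bigr do rewrite expr_div_n.
rewrite prodf_div -(subnK db) exprD addnK -mulrA; congr (_ * _).
by rewrite prodrXr -mdegE mulrCA mulfV ?mulr1 // expf_neq0.
Qed.

(** The power of z_0 = 0 is 1 on monomials of degree [2 * D] and 0 on all others. *)
Lemma heval_infinity D p z : (msize p <= (2 * D).+1)%N -> z ord0 = 0 ->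
  heval D p z = (pihomog mdeg (2 * D) p).@[fun i => z (lift ord0 i)].
Proof.
move=> pD z0; rewrite /heval pihomogE raddf_sum /= [RHS]big_mkcond /=.
apply: eq_big_seq => b bp; have db := msupp_mdeg_le pD bp.
rewrite z0 expr0n subn_eq0; case: (eqVneq (mdeg b) (2 * D)%N) => [->|nd].
  by rewrite leqnn mul1r mevalZ mevalX.
by rewrite leqNgt ltn_neqAle nd db mul0r mulr0.
Qed.

(** With a positive pivot y_ii, vanishing gives y_jk = y_ij y_ik / y_ii for all j, k. This also
    forces the symmetry of Y, which [ymon] by itself does not have. *)
Definition yminor (i j k : 'I_n.+1) : {mpoly R[dimU]} :=
  ymon i i * ymon j k - ymon i j * ymon i k.

Definition ytrace : {mpoly R[dimU]} := sumX R dimU - \sum_i ymon i i.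

(* Vanishes at a point of the simplex iff the matrix of the values of ymon is
   of the form z z^T with z a unit vector. *)
Definition penalty : {mpoly R[dimU]} :=
  \sum_i \sum_j \sum_k yminor i j k ^+ 2 + (sumX R dimU * ytrace) ^+ 2.

Lemma sumX_homog M : sumX R M \is 1.-homog.
Proof. by apply: rpred_sum => k _; rewrite dhomogX /= mdeg1. Qed.

(** The factor [sumX], equal to 1 on the simplex, brings the trace term to the degree of the squared
    minors. *)
Lemma penalty_homog : penalty \is 4.-homog.
Proof.
have hm : penalty \is (2 * 2).-homog; last exact: hm.
rewrite rpredD // ?dhomogMn //.
  do 3!(apply: rpred_sum => ? _); apply: dhomogMn.
  by rewrite rpredB // -[2%N]/(1 + 1)%N dhomogM ?ymon_homog.
rewrite -[2%N]/(1 + 1)%N dhomogM ?sumX_homog // rpredB ?sumX_homog //.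
by apply: rpred_sum => i _; apply: ymon_homog.
Qed.

(** At u(x) the matrix Y is z z^T with z = (1, x), and its trace 1 + |x|^2 is the value of [sumX]
    there. *)
Lemma penalty_comp : penalty \mPo usq = 0.
Proof.
have mC p q : (p * q) \mPo usq = (p \mPo usq) * (q \mPo usq) by rewrite rmorphM.
have trE : (\sum_i ymon i i) \mPo usq = one_plus_normsq R n.
  rewrite raddf_sum /= big_ord_recl ymon_comp /hcoord unlift_none mulr1.
  rewrite /one_plus_normsq.
  by congr (_ + _); apply: eq_bigr => i _; rewrite ymon_comp /hcoord liftK expr2.
rewrite /penalty comp_mpolyD rmorphXn /= mC /ytrace comp_mpolyB sumX_comp trE.
rewrite subrr mulr0 expr0n addr0 raddf_sum big1 //= => i _.
rewrite raddf_sum big1 //= => j _; rewrite raddf_sum big1 //= => k _.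
rewrite rmorphXn /= /yminor comp_mpolyB !mC !ymon_comp.
by rewrite (_ : _ - _ = 0) ?expr0n //; ring.
Qed.

(** All squares in the penalty vanish. As the trace is 1, some y_ii is positive, and z_j = y_ij /
    sqrt(y_ii) works by the minors with pivot i. *)
Lemma penalty_zero (th : 'I_dimU -> R) :
  \sum_k th k = 1 -> penalty.@[th] <= 0 ->
  exists2 z : 'I_n.+1 -> R, \sum_i z i ^+ 2 = 1 &
    forall i j, (ymon i j).@[th] = z i * z j.
Proof.
move=> th1; have sX : (sumX R dimU).@[th] = 1.
  by rewrite /sumX raddf_sum /= -th1; apply: eq_bigr => k _; rewrite mevalXU.
rewrite /penalty mevalD rmorphXn /= mevalM sX mul1r => pen0.
have S3 : 0 <= \sum_i \sum_j \sum_k (yminor i j k).@[th] ^+ 2.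
  by do 3!(apply: sumr_ge0 => ? _); apply: sqr_ge0.
have E3 : (\sum_i \sum_j \sum_k yminor i j k ^+ 2).@[th] =
    \sum_i \sum_j \sum_k (yminor i j k).@[th] ^+ 2.
  by do 3!(rewrite raddf_sum /=; apply: eq_bigr => ? _); rewrite rmorphXn.
rewrite E3 in pen0; have tr2 := sqr_ge0 (ytrace.@[th]).
have tr0 : ytrace.@[th] = 0.
  apply/eqP; rewrite -sqrf_eq0; apply/eqP/le_anti; rewrite tr2 andbT.
  by apply: le_trans pen0; rewrite lerDr.
have min0 i j k : (yminor i j k).@[th] = 0.
  apply/eqP; rewrite -sqrf_eq0; apply/eqP/le_anti; rewrite sqr_ge0 andbT.
  move: pen0; rewrite tr0 expr0n addr0; apply: le_trans.
  rewrite (bigD1 i) //= (bigD1 j) //= (bigD1 k) //= -!addrA lerDl.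
  by rewrite !addr_ge0 //; do ?[apply: sumr_ge0 => ? _]; apply: sqr_ge0.
pose y i j := (ymon i j).@[th].
have yE i j k : y i i * y j k = y i j * y i k.
  by have := min0 i j k; rewrite /yminor mevalB !mevalM => /eqP; rewrite subr_eq0 => /eqP.
have trE : \sum_i y i i = 1.
  have tE : (\sum_i ymon i i).@[th] = \sum_i y i i by rewrite raddf_sum.
  by move: tr0; rewrite /ytrace mevalB sX tE => /eqP; rewrite subr_eq0 => /eqP <-.
have [i0 yi0] : exists i, 0 < y i i.
  apply: contrapT => /forallNP yneg.
  suff : \sum_i y i i <= 0 by rewrite trE ler10.
  by apply: sumr_le0 => i _; rewrite leNgt; apply/negP.
have s0 : 0 < Num.sqrt (y i0 i0) by rewrite sqrtr_gt0.
have ss : Num.sqrt (y i0 i0) ^+ 2 = y i0 i0 by rewrite sqr_sqrtr // ltW.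
pose z j := y i0 j / Num.sqrt (y i0 i0).
have zz j k : y j k = z j * z k.
  rewrite /z mulrACA -invfM -expr2 ss -yE mulrAC mulfV ?mul1r // gt_eqF //.
exists z => // ; rewrite -[RHS]trE; apply: eq_bigr => i _.
by rewrite zz expr2.
Qed.

End Lifting.

(** * The certificate *)

Section Certificate.
Variable R : realType.
Local Open Scope classical_set_scope.

(** * Continuity of polynomial functions; compactness of the simplex and the sphere *)

Lemma cont_mul (T : topologicalType) (f h : T -> R) :
  continuous f -> continuous h -> continuous (fun x => f x * h x).
Proof. by move=> cf ch x; apply: cvgM; [apply: cf|apply: ch]. Qed.

Lemma cont_sub (T : topologicalType) (f h : T -> R) :
  continuous f -> continuous h -> continuous (fun x => f x - h x).
Proof. by move=> cf ch x; apply: cvgB; [apply: cf|apply: ch]. Qed.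

Lemma cont_add (T : topologicalType) (f h : T -> R) :
  continuous f -> continuous h -> continuous (fun x => f x + h x).
Proof. by move=> cf ch x; apply: cvgD; [apply: cf|apply: ch]. Qed.

Lemma cont_norm (T : topologicalType) (f : T -> R) :
  continuous f -> continuous (fun x => `|f x|).
Proof. by move=> cf x; apply: cvg_norm; apply: cf. Qed.

Lemma cont_prod (T : topologicalType) (J : Type) (r : seq J) (g : J -> T -> R) :
  (forall j, continuous (g j)) -> continuous (fun x => \prod_(j <- r) g j x).
Proof.
move=> cg x; elim: r => [|j r IHr].
  under eq_fun do rewrite big_nil; exact: cvg_cst.
under eq_fun do rewrite big_cons.
by apply: cvgM => //; apply: cg.
Qed.

Lemma cont_expr (T : topologicalType) (f : T -> R) k :
  continuous f -> continuous (fun x => f x ^+ k).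
Proof.
move=> cf x; elim: k => [|k IHk].
  under eq_fun do rewrite expr0.
  exact: (@cst_continuous _ _ (1 : R) x).
under eq_fun do rewrite exprS.
by apply: cvgM => //; apply: cf.
Qed.

Lemma cont_coordX M (i : 'I_M) k : continuous (fun x : 'rV[R]_M => x 0 i ^+ k).
Proof. by apply: cont_expr; apply: coord_continuous. Qed.

Lemma cont_meval M (p : {mpoly R[M]}) :
  continuous (fun th : 'rV[R]_M => p.@[fun i => th 0 i]).
Proof.
have -> : (fun th : 'rV[R]_M => p.@[fun i => th 0 i]) =
    (fun th => \sum_(b <- msupp p) p@_b * \prod_i th 0 i ^+ b i).
  by apply: funext => th; rewrite mevalE.
apply: cont_sum => b; apply: cont_mul; first exact: cst_continuous.
apply: (@cont_prod _ _ _ (fun i (x : 'rV[R]_M) => x 0 i ^+ b i)) => i.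
exact: cont_coordX.
Qed.

Lemma cont_meval1 M (T : topologicalType) (p : {mpoly R[M]}) :
  continuous (fun x : 'rV[R]_M * T => p.@[fun i => x.1 0 i]).
Proof.
move=> x; apply: (@continuous_comp _ _ _ fst
  (fun th : 'rV[R]_M => p.@[fun i => th 0 i])).
  exact: cvg_fst.
exact: cont_meval.
Qed.

Lemma compact_zero_set M (h : 'rV[R]_M -> R) :
  continuous h -> (forall x, h x = 0 -> forall i, `|x 0 i| <= 1) ->
  compact [set x | h x = 0].
Proof.
move=> ch bh; apply: bounded_closed_compact.
  exists 1; split=> // B B1 x /= hx.
  rewrite [leLHS]/Num.norm /= mx_normrE; apply: bigmax_le => [|[i j] _].
    by apply: le_trans (ltW B1).
  by rewrite (ord1 i) /=; apply: le_trans (bh x hx j) (ltW B1).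
exact: (closed_comp (fun x _ => ch x) (@closed_eq R 0)).
Qed.

Definition simplex M : set 'rV[R]_M :=
  [set th | (forall k, 0 <= th 0 k) /\ \sum_k th 0 k = 1].

Definition usphere M : set 'rV[R]_M := [set v | \sum_k v 0 k ^+ 2 = 1].

Lemma compact_simplex M : compact (simplex (M := M)).
Proof.
pose h (th : 'rV[R]_M) :=
  \sum_k (`|th 0 k| - th 0 k) + `|\sum_k th 0 k - 1|.
have cS : continuous (fun th : 'rV[R]_M => \sum_k th 0 k).
  by apply: cont_sum => k; apply: coord_continuous.
have ch : continuous h.
  apply: cont_add.
    apply: (@cont_sum _ _ _ _ (fun k (th : 'rV[R]_M) => `|th 0 k| - th 0 k)) => k.
    by apply: cont_sub; [apply: cont_norm|]; apply: coord_continuous.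
  by apply: cont_norm; apply: cont_sub => //; apply: cst_continuous.
have kge0 (th : 'rV[R]_M) k : 0 <= `|th 0 k| - th 0 k by rewrite subr_ge0 ler_norm.
have h0S th : h th = 0 -> simplex th.
  move=> /eqP; rewrite paddr_eq0 ?sumr_ge0 // => /andP [].
  rewrite psumr_eq0 // => /allP s0; rewrite normr_eq0 subr_eq0 => /eqP s1.
  split=> // k; have := s0 k (mem_index_enum k).
  by rewrite subr_eq0 => /eqP <-.
have -> : simplex (M := M) = [set th | h th = 0].
  apply/seteqP; split=> th /=; last exact: h0S.
  move=> [th0 th1]; rewrite /h th1 subrr normr0 addr0 big1 // => k _.
  by rewrite ger0_norm ?subrr.
apply: compact_zero_set => // th /h0S [th0 th1] i.
by rewrite ger0_norm // -th1 (bigD1 i) //= lerDl sumr_ge0.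
Qed.

Lemma compact_usphere M : compact (usphere (M := M)).
Proof.
have -> : usphere (M := M) = [set v | \sum_k v 0 k ^+ 2 - 1 = 0].
  by apply/seteqP; split=> v /= /eqP; rewrite ?subr_eq0 => /eqP // ->; rewrite subrr.
apply: compact_zero_set.
  apply: cont_sub; last exact: cst_continuous.
  apply: (@cont_sum _ _ _ _ (fun k (v : 'rV[R]_M) => v 0 k ^+ 2)) => k.
  exact: cont_coordX.
move=> v /eqP; rewrite subr_eq0 => /eqP v1 i.
rewrite -(@ler_pXn2r _ 2) ?nnegrE // expr1n real_normK ?num_real // -v1.
by rewrite (bigD1 i) //= lerDl sumr_ge0 // => k _; rewrite sqr_ge0.
Qed.

(** An entry costs at most eps |v_a v_b| <= eps (v_a^2 + v_b^2) / 2. *)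
Lemma qform_perturb m (A B : 'M[R]_m) (eps : R) (v : 'cV[R]_m) :
  (forall a b, `|B a b - A a b| <= eps) ->
  qform A v - eps * m%:R * \sum_a v a 0 ^+ 2 <= qform B v.
Proof.
move=> AB; rewrite !qformE lerBlDr -lerBlDl -sumrB.
apply: (@le_trans _ _ (\sum_a \sum_b eps * ((v a 0 ^+ 2 + v b 0 ^+ 2) / 2))).
  apply: ler_sum => a _; rewrite -sumrB; apply: ler_sum => b _.
  rewrite -mulrBl -mulrBr.
  have := AB a b; rewrite ler_norml; have := sqr_ge0 (v a 0 - v b 0).
  have := sqr_ge0 (v a 0 + v b 0).
  move: (v a 0) (v b 0) => x y hp hm /andP [h1 h2].
  have xy : x * y <= (x ^+ 2 + y ^+ 2) / 2 by lra.
  have xyn : - (x * y) <= (x ^+ 2 + y ^+ 2) / 2 by lra.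
  have e0 : 0 <= eps by lra.
  have -> : x * (A a b - B a b) * y = (A a b - B a b) * (x * y) by ring.
  have [c0|c0] := lerP 0 (A a b - B a b).
    apply: le_trans (ler_wpM2l c0 xy) _; apply: ler_wpM2r; lra.
  have c1 : 0 <= - (A a b - B a b) by lra.
  rewrite -[leLHS]mulrNN; apply: le_trans (ler_wpM2l c1 xyn) _.
  by apply: ler_wpM2r; lra.
rewrite le_eqVlt; apply/orP; left; apply/eqP.
under eq_bigr do rewrite -mulr_sumr -mulr_suml big_split /= sumr_const card_ord.
rewrite -mulr_sumr -mulr_suml big_split /= sumr_const card_ord sumrMnl.
by rewrite -mulr_natr; field.
Qed.

Variables (n m q delta : nat) (P : 'M[{mpoly R[n]}]_m) (g : 'I_q -> {mpoly R[n]}).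
Variable E : 'I_q -> nat.
Hypothesis P_sym : P^T = P.
Hypothesis P_deg : forall a b, (msize (P a b) <= (2 * delta).+1)%N.
Hypothesis g_deg : forall j, (msize (g j) <= (2 * E j).+1)%N.
Hypothesis P_pos : forall x, semialg g x -> posdef (mxeval x P).
Hypothesis P_top : forall x : 'rV[R]_n, x != 0 ->
  posdef (mxeval x (hom_part (2 * delta) P)).

(** [None] is the constraint that minus the penalty be nonnegative, which on the simplex forces Y =
    z z^T with |z| = 1. *)
Let G (j : option 'I_q) : {mpoly R[dimU n]} :=
  if j is Some j' then ylift (E j') (g j') else - penalty R n.
Let e (j : option 'I_q) : nat := if j is Some j' then E j' else 4.

Let G_homog j : G j \is (e j).-homog.
Proof.
by case: j => [j|] /=; [apply: ylift_homog|rewrite rpredN; apply: penalty_homog].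
Qed.

(** Turns definiteness of the pulled-back matrix into positivity of a scalar function on the product
    of simplex and sphere. *)
Let Pform (x : 'rV[R]_(dimU n) * 'rV[R]_m) : R :=
  \sum_a \sum_b x.2 0 a * (ylift delta (P a b)).@[fun i => x.1 0 i] * x.2 0 b.

Lemma Pform_pos x : (simplex (M := dimU n) `*` usphere (M := m)) x ->
  (forall j, 0 <= (G j).@[fun i => x.1 0 i]) -> 0 < Pform x.
Proof.
case: x => th v [/= [th0 th1] v1] Gpos; pose et i := th 0 i.
have [z z1 yz] : exists2 z : 'I_n.+1 -> R, \sum_i z i ^+ 2 = 1 &
    forall i j, (ymon R i j).@[et] = z i * z j.
  by apply: penalty_zero => //; have := Gpos None; rewrite /= mevalN oppr_ge0.
pose x : 'rV[R]_n := \row_i z (lift ord0 i).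
have vT0 : v^T != 0.
  apply: contraTneq (oner_neq0 R) => v0; rewrite negbK -v1 big1 // => k _.
  by have := congr1 (fun w : 'cV[R]_m => w k 0) v0; rewrite !mxE => ->; rewrite expr0n.
have PE : Pform (th, v) = \sum_a \sum_b v 0 a * heval delta (P a b) z * v 0 b.
  by apply: eq_bigr => a _; apply: eq_bigr => b _ /=; rewrite (ylift_eval (P_deg a b) yz).
(* If z_0 = 0 this is a point at infinity, where only the leading form is seen. *)
have [z0|z0] := eqVneq (z ord0) 0.
  have x0 : x != 0.
    apply: contraTneq (oner_neq0 R) => x0; rewrite negbK -z1 big_ord_recl z0.
    rewrite expr0n add0r big1 // => k _.
    by have := congr1 (fun w : 'rV[R]_n => w 0 k) x0; rewrite !mxE => ->; rewrite expr0n.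
  have [_ /(_ _ vT0)] := P_top x0; rewrite -/(qform _ _) qformE PE.
  congr (0 < _); apply: eq_bigr => a _; apply: eq_bigr => b _.
  rewrite !mxE heval_infinity //; congr (_ * _ * _); apply: meval_eq => i.
  by rewrite mxE.
(* The affine point represented by z. Only even powers of z_0 occur as factors, so signs carry
   over. *)
pose y : 'rV[R]_n := \row_i (z (lift ord0 i) / z ord0).
have gy : semialg g y.
  move=> j; have := Gpos (Some j); rewrite /= (ylift_eval (g_deg j) yz).
  rewrite heval_affine // exprM pmulr_rge0; last first.
    by rewrite exprn_gt0 // lt_neqAle eq_sym sqrf_eq0 z0 sqr_ge0.
  by congr (0 <= _); apply: meval_eq => i; rewrite mxE.
have [_ /(_ _ vT0)] := P_pos gy; rewrite -/(qform _ _) qformE.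
have z2 : 0 < z ord0 ^+ (2 * delta).
  by rewrite exprM exprn_gt0 // lt_neqAle eq_sym sqrf_eq0 z0 sqr_ge0.
rewrite -(pmulr_rgt0 _ z2) PE; congr (0 < _).
rewrite mulr_sumr; apply: eq_bigr => a _; rewrite mulr_sumr; apply: eq_bigr => b _.
rewrite !mxE heval_affine //.
rewrite (@meval_eq _ _ _ (fun i => y 0 i)) => [|i]; last by rewrite mxE.
by ring.
Qed.

Let sigma := one_plus_normsq R n.

Lemma cont_Pform : continuous Pform.
Proof.
apply: cont_sum => a.
apply: (@cont_sum _ _ _ _ (fun b (x : 'rV[R]_(dimU n) * 'rV[R]_m) =>
  x.2 0 a * (ylift delta (P a b)).@[fun i => x.1 0 i] * x.2 0 b)) => b.
have c2 i : continuous (fun x : 'rV[R]_(dimU n) * 'rV[R]_m => x.2 0 i).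
  move=> x; apply: (@continuous_comp _ _ _ snd (fun v : 'rV[R]_m => v 0 i)).
    exact: cvg_snd.
  exact: coord_continuous.
by apply: cont_mul => //; apply: cont_mul => //; apply: cont_meval1.
Qed.

(** Subtracting the homogenized correction of [compact_positivity] on the diagonal leaves a form
    positive definite on the simplex, so its coefficient matrices [B w] are positive semidefinite
    for large [N]. Substituting [usq] gives the identity. *)
Lemma exists_certificate : exists (c : R) (k N0 : nat),
  forall N, (N0 <= N)%N ->
  [/\ (delta <= N)%N, forall j, (E j * (2 * k).+1 <= N)%N &
    exists B : {ffun 'I_N -> 'I_(dimU n)} -> 'M[R]_m,
    [/\ forall w, possemidef (B w),
        forall w a b, a != b -> P a b = 0 -> B w a b = 0 &
        sigma ^+ (N - delta) *: P =
          \sum_(w : {ffun 'I_N -> 'I_(dimU n)}) (\prod_i uroot R (w i)) ^+ 2 *: map_mx (@mpolyC n R) (B w) +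
          (\sum_j g j * (sigma ^+ (N - E j * (2 * k).+1) *
                         (sigma ^+ E j - c *: g j) ^+ (2 * k)))%:M]].
Proof.
pose K := simplex (M := dimU n) `*` usphere (M := m).
have cK : compact K.
  by apply: compact_setX; [apply: compact_simplex|apply: compact_usphere].
pose gf j (x : 'rV[R]_(dimU n) * 'rV[R]_m) := (G j).@[fun i => x.1 0 i].
have cg j : continuous (gf j) by apply: cont_meval1.
have [c [k [d [c0 d0 hd]]]] := compact_positivity cK cont_Pform cg Pform_pos.
(* A common degree for the pulled-back matrix and all correction terms, reached by padding with
   powers of [tau]. *)
pose D := maxn delta (\max_j e j * (2 * k).+1).
have Dd : (delta <= D)%N by rewrite leq_maxl.
have De j : (e j * (2 * k).+1 <= D)%N.
  by rewrite /D leq_max (leq_bigmax j) orbT.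
pose tau := sumX R (dimU n).
pose corr := \sum_j tau ^+ (D - e j * (2 * k).+1) *
  (G j * (tau ^+ e j - c *: G j) ^+ (2 * k)).
have tauX i : tau ^+ i \is i.-homog.
  by have := dhomogMn i (sumX_homog R (dimU n)); rewrite mul1n.
have corr_homog : corr \is D.-homog.
  apply: rpred_sum => j _; have := dhomogM (tauX (D - e j * (2 * k).+1)%N)
    (dhomogM (G_homog j) (dhomogMn (2 * k) (_ : tau ^+ e j - c *: G j \is (e j).-homog))).
  rewrite -mulnS subnK //; apply.
  by rewrite rpredB ?rpredZ ?G_homog ?tauX.
pose F a b := tau ^+ (D - delta) * ylift delta (P a b) - corr *+ (a == b).
have F_homog a b : F a b \is D.-homog.
  rewrite rpredB ?rpredMn //.
  by have := dhomogM (tauX (D - delta)%N) (ylift_homog (P_deg a b)); rewrite subnK.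
(* An entrywise error [eps] costs at most eps m |v|^2 <= d |v|^2; the successor keeps the
   denominator nonzero for m = 0. *)
pose eps := d / m.+1%:R; have eps0 : 0 < eps by rewrite divr_gt0.
have /choice [Nab hNab] (ab : 'I_m * 'I_m) : exists N0,
    forall N (w : {ffun 'I_N -> 'I_(dimU n)}), (N0 <= N)%N ->
    `|bern (F ab.1 ab.2) w - (F ab.1 ab.2).@[fun i => freq R w 0 i]| <= eps.
  exact: bern_approx (F_homog ab.1 ab.2) eps0.
exists c, k, (maxn 1 (maxn D (\max_ab Nab ab))) => N.
rewrite geq_max => /andP [N0]; rewrite geq_max => /andP [DN NabN].
split; [exact: leq_trans Dd DN|by move=> j; apply: leq_trans (De (Some j)) DN|].
exists (fun w => \matrix_(a, b) bern (F a b) w).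
have PE a b : P a b = P b a by rewrite -{1}P_sym mxE.
pose s th := \sum_j gf j th * (1 - c * gf j th) ^+ (2 * k).
have FE th a b : simplex th -> (F a b).@[fun i => th 0 i] =
    (ylift delta (P a b)).@[fun i => th 0 i] - s (th, 0) *+ (a == b).
  move=> [_ th1]; have tau1 : tau.@[fun i => th 0 i] = 1.
    by rewrite /tau /sumX raddf_sum /= -th1; apply: eq_bigr => i _; rewrite mevalXU.
  rewrite /F mevalB mevalM rmorphXn /= tau1 expr1n mul1r mevalMn; congr (_ - _ *+ _).
  rewrite /corr raddf_sum /=; apply: eq_bigr => j _.
  by rewrite !mevalM !rmorphXn /= mevalB rmorphXn /= mevalZ tau1 !expr1n mul1r.
(* The bound [hd] concerns unit vectors; both sides are quadratic in [v], so it extends by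
   rescaling. *)
have F_lower th (v : 'cV[R]_m) : simplex th -> d * \sum_a v a 0 ^+ 2 <=
    qform (\matrix_(a, b) (F a b).@[fun i => th 0 i]) v.
  move=> thS; rewrite qformE.
  have -> : \sum_a \sum_b v a 0 * (\matrix_(a, b) (F a b).@[fun i => th 0 i]) a b
      * v b 0 = Pform (th, v^T) - s (th, 0) * \sum_a v a 0 ^+ 2.
    rewrite mulr_sumr -sumrB; apply: eq_bigr => a _ /=.
    rewrite [X in _ - X](_ : _ = \sum_b v a 0 * (s (th, 0) *+ (a == b)) * v b 0).
      rewrite -sumrB; apply: eq_bigr => b _; rewrite !mxE FE //.
      by rewrite mulrBr mulrBl.
    rewrite (bigD1 a) //= eqxx big1 => [|b /negbTE ba].
      by rewrite addr0 mulr1n expr2; ring.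
    by rewrite eq_sym ba mulr0n mulr0 mul0r.
  set S := \sum_a v a 0 ^+ 2.
  have S0 : 0 <= S by apply: sumr_ge0 => a _; rewrite sqr_ge0.
  have [S1|S1] := eqVneq S 0.
    have v0 : v = 0.
      apply/colP => a; apply/eqP; rewrite mxE -sqrf_eq0.
      by move/eqP: S1; rewrite psumr_eq0 => [/allP /(_ a (mem_index_enum _))|? _];
        rewrite ?sqr_ge0.
    rewrite S1 !mulr0 subr0 /Pform big1 // => a _; rewrite big1 // => b _.
    by rewrite v0 /= !mxE mulr0.
  pose r := Num.sqrt S; have r2 : r ^+ 2 = S by rewrite sqr_sqrtr.
  have r0 : r != 0 by rewrite -sqrf_eq0 r2.
  pose u := r^-1 *: v^T.
  have Ku : K (th, u).
    split=> //; rewrite /usphere /=.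
    under eq_bigr do rewrite !mxE exprMn.
    by rewrite -mulr_sumr -/S -r2 exprVn mulVf // expf_neq0.
  have := ler_wpM2l S0 (hd _ Ku); rewrite -/(s _) [d * _]mulrC mulrBr => /le_trans.
  apply; rewrite [S * s _]mulrC lerD2r /Pform mulr_sumr le_eqVlt; apply/orP; left.
  apply/eqP; apply: eq_bigr => a _; rewrite mulr_sumr; apply: eq_bigr => b _ /=.
  by rewrite !mxE -r2; field.
split=> [w|w a b ab Pab|].
- split; first by apply/matrixP => a b; rewrite !mxE /F PE eq_sym.
  move=> v; rewrite -/(qform _ v) qformE.
  pose A : 'M[R]_m := \matrix_(a, b) (F a b).@[fun i => freq R w 0 i].
  have thS : simplex (freq R w) by split; [apply: freq_ge0|apply: sum_freq].
  have A_ge : d * \sum_a v a 0 ^+ 2 <= qform A v.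
    exact: F_lower.
  have AB a b : `|(\matrix_(a, b) bern (F a b) w) a b - A a b| <= eps.
    rewrite !mxE; apply: (hNab (a, b)).
    by apply: leq_trans NabN; apply: (leq_bigmax (a, b)).
  rewrite -qformE; apply: le_trans (qform_perturb v AB).
  rewrite subr_ge0; apply: le_trans A_ge; rewrite ler_wpM2r ?sumr_ge0 //.
    by move=> a _; rewrite sqr_ge0.
  rewrite /eps mulrAC ler_pdivrMr // ler_wpM2l // ?ler_nat //; exact: ltW.
(* The correction is diagonal, so off-diagonal zeros of [P] persist. *)
- by rewrite mxE /F Pab ylift0 mulr0 (negbTE ab) mulr0n subr0 bern0.
apply/matrixP => a b.
have compM p p' : (p * p') \mPo usq R n = (p \mPo usq R n) * (p' \mPo usq R n).
  by rewrite rmorphM.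
have compX p i : (p ^+ i) \mPo usq R n = (p \mPo usq R n) ^+ i by rewrite rmorphXn.
have tauC : tau \mPo usq R n = sigma by apply: sumX_comp.
have corrC : corr \mPo usq R n = \sum_j sigma ^+ (D - E j * (2 * k).+1) *
    (g j * (sigma ^+ E j - c *: g j) ^+ (2 * k)).
  rewrite /corr raddf_sum /= (bigD1 None) //= !compM comp_mpolyN penalty_comp.
  rewrite oppr0 mul0r mulr0 add0r (reindex_omap Some id) => [|[j|] //].
  apply: eq_big => [j|j _]; first by rewrite eqxx.
  rewrite !compM !compX comp_mpolyB comp_mpolyZ compX tauC.
  by rewrite /= !ylift_comp.
have := congr1 (comp_mpoly (usq R n)) (bernE (F_homog a b) DN).
rewrite compM compX tauC /F comp_mpolyB compM compX tauC ylift_comp //.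
rewrite comp_mpolyMn corrC raddf_sum /= mulrBr mulrA -exprD addnBA //.
rewrite subnK //.
move/eqP; rewrite subr_eq => /eqP E1.
rewrite !mxE summxE E1; congr (_ + _).
  apply: eq_bigr => w _; rewrite comp_mpolyZ rmorph_prod /= !mxE -mul_mpolyC mulrC.
  congr (_ * _); rewrite -prodrXl; apply: eq_bigr => i _.
  by rewrite comp_mpolyXU -tnth_nth tnth_mktuple.
rewrite mulrnAr; congr (_ *+ _); rewrite mulr_sumr; apply: eq_bigr => j _.
rewrite [LHS]mulrA -exprD addnBA; last exact: (De (Some j)).
rewrite subnK //; ring.
Qed.

End Certificate.

(** * Degrees and sums of squares *)

Section Vanishing.
Variable R : realType.

(** Otherwise the first [size p] natural numbers would be too many roots. *)
Lemma poly_eq0_of_horner (p : {poly R}) : (forall t, p.[t] = 0) -> p = 0.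
Proof.
move=> p0; apply/eqP; apply: contraT => nz.
pose rs : seq R := [seq k%:R | k <- iota 0 (size p)].
have := @max_poly_roots _ p rs nz; rewrite size_map size_iota ltnn; apply.
  by apply/allP => t _; rewrite rootE p0.
by rewrite map_inj_uniq ?iota_uniq //; apply: mulrIn; rewrite oner_eq0.
Qed.

(* Scaling the i-th coordinate by t separates the monomials according to their
   exponent in the i-th variable. *)
Lemma mpoly_eq0_of_meval n (p : {mpoly R[n]}) :
  (forall x : 'I_n -> R, p.@[x] = 0) -> p = 0.
Proof.
move=> p0; apply/mpolyP => b0; rewrite mcoeff0.
have vanish (s : seq 'I_n) (x : 'I_n -> R) :
    \sum_(b <- msupp p | all (fun i => b i == b0 i) s)
      p@_b * \prod_j x j ^+ b j = 0.
  elim: s x => [|i s IHs] x /=; first by have := p0 x; rewrite mevalE.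
  pose Q : {poly R} := \sum_(b <- msupp p | all (fun i => b i == b0 i) s)
      (p@_b * \prod_j x j ^+ b j) *: 'X^(b i).
  have Q0 : Q = 0.
    apply: poly_eq0_of_horner => t; rewrite /Q horner_sum.
    rewrite -[RHS](IHs (fun j => if j == i then x j * t else x j)).
    apply: eq_bigr => b _; rewrite hornerZ hornerXn -mulrA; congr (_ * _).
    rewrite (bigD1 i) //= [RHS](bigD1 i) //= eqxx exprMn.
    rewrite [\prod_(_ | _) (if _ then _ else _) ^+ _](eq_bigr (fun j => x j ^+ b j)).
      by ring.
    by move=> j /negbTE ->.
  have := congr1 (fun P : {poly R} => P`_(b0 i)) Q0.
  rewrite coef0 /Q coef_sum => E; rewrite -[RHS]E big_mkcondl /=.
  apply: eq_bigr => b _; rewrite coefZ coefXn eq_sym.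
  by case: eqP => _; rewrite ?mulr1 ?mulr0.
have := vanish (enum 'I_n) (fun=> 1).
under eq_bigr => b _.
  rewrite big1 ?mulr1 => [|j _]; last by rewrite expr1n.
  over.
rewrite (eq_bigl (pred1 b0)) => [|b]; last first.
  apply/allP/eqP => [h|-> //]; apply/mnmP => i.
  by apply/eqP; apply: h; rewrite mem_enum.
have [b0p|b0p _] := boolP (b0 \in msupp p); last by rewrite memN_msupp_eq0.
rewrite big_mkcond (bigD1_seq b0) //= eqxx big1 ?addr0 // => b bb0.
by rewrite (negbTE bb0).
Qed.

End Vanishing.

(** * Degree bounds for sums of squares *)

Section Degree.
Variables (R : realType) (n : nat).
Implicit Types p q : {mpoly R[n]}.

(** As [msize] is the degree plus 1, and 0 for the zero polynomial, bounds of the form [d.+1] cover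
    the zero polynomial too. *)
Lemma msizeD_leS d p q : (msize p <= d.+1)%N -> (msize q <= d.+1)%N ->
  (msize (p + q) <= d.+1)%N.
Proof. by move=> hp hq; apply: leq_trans (msizeD_le _ _) _; rewrite geq_max hp. Qed.

Lemma msize_sum_leS d (J : Type) (r : seq J) (A : pred J) (F : J -> {mpoly R[n]}) :
  (forall j, A j -> (msize (F j) <= d.+1)%N) ->
  (msize (\sum_(j <- r | A j) F j) <= d.+1)%N.
Proof.
move=> hF; elim/big_ind: _ => //; first by rewrite msize0.
by move=> p q; apply: msizeD_leS.
Qed.

Lemma msizeM_leS d e p q : (msize p <= d.+1)%N -> (msize q <= e.+1)%N ->
  (msize (p * q) <= (d + e).+1)%N.
Proof.
move=> hp hq; have [->|p0] := eqVneq p 0; first by rewrite mul0r msize0.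
have [->|q0] := eqVneq q 0; first by rewrite mulr0 msize0.
rewrite msizeM //; have := leq_add hp hq; rewrite addSn addnS.
by case: (msize p + msize q)%N.
Qed.

Lemma msizeX_leS d k p : (msize p <= d.+1)%N -> (msize (p ^+ k) <= (d * k).+1)%N.
Proof.
move=> hp; elim: k => [|k IHk]; first by rewrite expr0 msize1 muln0.
by rewrite exprS mulnS msizeM_leS.
Qed.

Lemma msize_hcoord i : (msize (hcoord R (n := n) i) <= 2)%N.
Proof.
rewrite /hcoord; case: unlift => [k|]; last by rewrite msize1.
by rewrite msizeX mdeg1.
Qed.

Lemma msize_uroot k : (msize (uroot R (n := n) k) <= 2)%N.
Proof.
rewrite /uroot; case: udecode => [[i j] s].
apply: leq_trans (msizeZ_le _ _) _; apply: msizeD_leS; first exact: msize_hcoord.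
by apply: leq_trans (msizeZ_le _ _) _; apply: msize_hcoord.
Qed.

Lemma msize_prod_uroot N (w : 'I_N -> 'I_(dimU n)) :
  (msize (\prod_i uroot R (w i)) <= N.+1)%N.
Proof.
have -> : \prod_i uroot R (w i) = \prod_(i <- enum 'I_N) uroot R (w i).
  by rewrite big_enum.
rewrite -[X in (_ <= X.+1)%N](size_enum_ord N).
elim: (enum _) => [|i s IHs]; first by rewrite big_nil msize1.
by rewrite big_cons; apply: (msizeM_leS (msize_uroot _) IHs).
Qed.

Lemma msize_one_plus_normsq : (msize (one_plus_normsq R n) <= 3)%N.
Proof.
apply: msizeD_leS; first by rewrite msize1.
apply: msize_sum_leS => i _; have := @msizeX_leS 1 2 ('X_i : {mpoly R[n]}).
by apply; rewrite msizeX mdeg1.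
Qed.

Variable p : nat.
Implicit Types S : 'M[{mpoly R[n]}]_p.

Definition sosle d S : Prop :=
  (exists (h : nat) (H : 'M[{mpoly R[n]}]_(h, p)), S = H^T *m H) /\
  forall a b, (msize (S a b) <= d.+1)%N.

Lemma sosle_sos_cone d e S : sosle d S -> (d <= e)%N -> sos_cone e S.
Proof.
move=> [sosS degS] de; split=> //; apply/bigmax_leqP => a _.
apply/bigmax_leqP => b _; apply: leq_trans de.
by rewrite /mpdeg; have := degS a b; case: (msize (S a b)).
Qed.

Lemma sosle0 d : sosle d 0.
Proof.
split; last by move=> a b; rewrite mxE msize0.
by exists 0%N, 0; rewrite mulmx0.
Qed.

Lemma sosleD d S1 S2 : sosle d S1 -> sosle d S2 -> sosle d (S1 + S2).
Proof.
move=> [[h1 [H1 E1]] d1] [[h2 [H2 E2]] d2]; split.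
  by exists (h1 + h2)%N, (col_mx H1 H2); rewrite tr_col_mx mul_row_col E1 E2.
by move=> a b; rewrite mxE msizeD_leS.
Qed.

Lemma sosle_sum d (J : Type) (r : seq J) (F : J -> 'M[{mpoly R[n]}]_p) :
  (forall j, sosle d (F j)) -> sosle d (\sum_(j <- r) F j).
Proof.
move=> hF; elim/big_ind: _ => //; first exact: sosle0.
exact: sosleD.
Qed.

Lemma sosle_sqr d e t S : (msize t <= e.+1)%N -> sosle d S ->
  sosle (2 * e + d) (t ^+ 2 *: S).
Proof.
move=> dt [[h [H E]] dS]; split.
  exists h, (t *: H); rewrite [(_ *: _)^T]linearZ /= -scalemxAl -scalemxAr.
  by rewrite scalerA -expr2 E.
by move=> a b; rewrite mxE; apply: msizeM_leS => //; rewrite mulnC msizeX_leS.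
Qed.

(** Multiplying by 1 + |x|^2 is a sum of multiplications by squares, each raising the degree bound
    by 2. *)
Lemma sosle_sigma d k S : sosle d S ->
  sosle (2 * k + d) (one_plus_normsq R n ^+ k *: S).
Proof.
move=> hS; elim: k => [|k IHk]; first by rewrite expr0 scale1r muln0 add0n.
rewrite exprS -scalerA; set S' := _ ^+ k *: S.
have -> : (2 * k.+1 + d = 2 * 1 + (2 * k + d))%N by lia.
have -> : one_plus_normsq R n *: S' = 1 ^+ 2 *: S' + \sum_i 'X_i ^+ 2 *: S'.
  by rewrite expr1n -scaler_suml -scalerDl.
apply: sosleD; first by apply: sosle_sqr => //; rewrite msize1.
by apply: sosle_sum => i; apply: sosle_sqr => //; rewrite msizeX mdeg1.
Qed.

Lemma sosle_gram h (H : 'M[R]_(h, p)) : sosle 0 (map_mx (@mpolyC n R) (H^T *m H)).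
Proof.
split; last by move=> a b; rewrite mxE; rewrite msizeC; case: eqP.
by exists h, (map_mx (@mpolyC n R) H); rewrite map_mxM map_trmx.
Qed.

End Degree.

(** * Feasible points *)

Section MatrixEvaluation.
Variables (R : realType) (n m : nat) (x : 'rV[R]_n).
Implicit Types A B : 'M[{mpoly R[n]}]_m.

Lemma mxevalD A B : mxeval x (A + B) = mxeval x A + mxeval x B.
Proof. by apply/matrixP => i j; rewrite !mxE mevalD. Qed.

Lemma mxevalZ p A : mxeval x (p *: A) = p.@[fun i => x 0 i] *: mxeval x A.
Proof. by apply/matrixP => i j; rewrite !mxE mevalM. Qed.

Lemma mxeval_sum (J : Type) (r : seq J) (F : J -> 'M[{mpoly R[n]}]_m) :
  mxeval x (\sum_(j <- r) F j) = \sum_(j <- r) mxeval x (F j).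
Proof. exact: map_mx_sum. Qed.

Lemma mxeval_conv c1 c2 A B :
  mxeval x (c1%:MP *: A + c2%:MP *: B) = c1 *: mxeval x A + c2 *: mxeval x B.
Proof. by rewrite mxevalD !mxevalZ !mevalC. Qed.

Lemma hom_part_conv d c1 c2 A B :
  hom_part d (c1%:MP *: A + c2%:MP *: B) =
  c1%:MP *: hom_part d A + c2%:MP *: hom_part d B.
Proof.
by apply/matrixP => i j; rewrite !mxE !mul_mpolyC linearD !linearZ.
Qed.

End MatrixEvaluation.

Section Pencil.
Variables (R : realType) (n m l : nat).
Variables (P0 : 'M[{mpoly R[n]}]_m) (P : 'I_l -> 'M[{mpoly R[n]}]_m).
Local Open Scope classical_set_scope.

Lemma pencil_conv (t : R) (lam mu : 'rV[R]_l) :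
  pencil P0 P (t *: lam + (1 - t) *: mu) =
  t%:MP *: pencil P0 P lam + (1 - t)%:MP *: pencil P0 P mu.
Proof.
rewrite /pencil.
have -> : \sum_i ((t *: lam + (1 - t) *: mu) 0 i)%:MP *: P i =
    t%:MP *: (\sum_i (lam 0 i)%:MP *: P i)
    + (1 - t)%:MP *: (\sum_i (mu 0 i)%:MP *: P i).
  rewrite !scaler_sumr -big_split; apply: eq_bigr => i _.
  by rewrite !mxE mpolyCD !mpolyCM scalerDl !scalerA.
rewrite !scalerBr {1}(_ : P0 = t%:MP *: P0 + (1 - t)%:MP *: P0); last first.
  by rewrite -scalerDl -mpolyCD addrC subrK scale1r.
by rewrite opprD addrACA.
Qed.

Lemma trmx_pencil lam : P0^T = P0 -> (forall i, (P i)^T = P i) ->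
  (pencil P0 P lam)^T = pencil P0 P lam.
Proof.
move=> hP0 hP; apply/matrixP => a b; rewrite !mxE !summxE.
congr (_ - _); first by rewrite -{1}hP0 mxE.
by apply: eq_bigr => i _; rewrite !mxE -{1}(hP i) mxE.
Qed.

Lemma mpdeg_msize d (p : {mpoly R[n]}) : (mpdeg p <= d)%N = (msize p <= d.+1)%N.
Proof. by rewrite /mpdeg; case: (msize p). Qed.

Lemma mxdeg_msize (A : 'M[{mpoly R[n]}]_m) a b : (msize (A a b) <= (mxdeg A).+1)%N.
Proof.
rewrite -mpdeg_msize /mxdeg.
by apply: leq_trans (leq_bigmax a); apply: (leq_bigmax b).
Qed.

Lemma msize_pencil lam a b :
  (msize (pencil P0 P lam a b) <= (pencil_deg P0 P).+1)%N.
Proof.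
rewrite mxE [X in _ + X]mxE; apply: msizeD_leS.
  by apply: leq_trans (mxdeg_msize _ _ _) _; rewrite ltnS leq_maxl.
rewrite msizeN summxE; apply: msize_sum_leS => i _.
rewrite mxE mul_mpolyC; apply: leq_trans (msizeZ_le _ _) _.
apply: leq_trans (mxdeg_msize _ _ _) _; rewrite ltnS /pencil_deg.
by apply: leq_trans (leq_maxr _ _); apply: (leq_bigmax i).
Qed.

Hypotheses (hP0 : P0^T = P0) (hP : forall i, (P i)^T = P i).

Lemma sparsity_graph_sym : ssrbool.symmetric (sparsity_graph P0 P).
Proof.
move=> i j; rewrite /sparsity_graph eq_sym; congr (_ && ~~ _).
have E lam : pencil P0 P lam i j = pencil P0 P lam j i.
  by rewrite -{1}(trmx_pencil lam hP0 hP) mxE.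
by apply/asboolP/asboolP => h lam x; have := h lam x; rewrite ![mxeval _ _ _ _]mxE E.
Qed.

Lemma sparsity_graph_irr : irreflexive (sparsity_graph P0 P).
Proof. by move=> i; rewrite /sparsity_graph eqxx. Qed.

(** The graph is defined through values, so the vanishing of polynomial functions has to be lifted
    to polynomials. *)
Lemma pencil_sparse lam : sparse (sparsity_graph P0 P) (pencil P0 P lam).
Proof.
move=> i j ij; rewrite /sparsity_graph ij negbK => /asboolP h.
apply: mpoly_eq0_of_meval => x; rewrite -[RHS](h lam (\row_k x k)) [RHS]mxE.
by apply: meval_eq => k; rewrite mxE.
Qed.

Variables (q : nat) (g : 'I_q -> {mpoly R[n]}) (t : nat) (C : 'I_t -> {set 'I_m}).
Let sigma := one_plus_normsq R n.

Lemma qform_gram h (H : 'M[R]_(h, m)) v : 0 <= qform (H^T *m H) v.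
Proof.
rewrite /qform mulmxA -trmx_mul -mulmxA mxE; apply: sumr_ge0 => i _.
by rewrite mxE -expr2 sqr_ge0.
Qed.

(** On the semialgebraic set the representation has a nonnegative form, and sigma, being positive
    everywhere, can be divided out. Hence every relaxation bounds the optimal value from above. *)
Lemma sos_feasible_sub_pmi d nu lam :
  sos_feasible P0 P g C sigma d nu lam -> pmi_feasible P0 P g lam.
Proof.
move=> [S0 [S [sosS0 sosS eqS]]] x gx; split.
  by rewrite /mxeval map_trmx trmx_pencil.
move=> v; rewrite -/(qform _ v).
have s_gt0 : 0 < sigma.@[fun i => x 0 i].
  rewrite /sigma /one_plus_normsq mevalD meval1 raddf_sum /= ltr_pwDl //.
  by apply: sumr_ge0 => i _; rewrite rmorphXn /= mevalXU sqr_ge0.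
rewrite -(pmulr_rge0 _ (exprn_gt0 nu s_gt0)).
have -> : sigma.@[fun i => x 0 i] ^+ nu * qform (mxeval x (pencil P0 P lam)) v =
    qform (mxeval x (sigma ^+ nu *: pencil P0 P lam)) v.
  by rewrite mxevalZ rmorphXn /= /qform -scalemxAr -scalemxAl [RHS]mxE.
have gram_ge0 (D : {set 'I_m}) (A : 'M[{mpoly R[n]}]_#|D|) : (exists (h : nat)
    (H : 'M[{mpoly R[n]}]_(h, #|D|)), A = H^T *m H) ->
    0 <= qform (mxeval x ((clique_mx _ D)^T *m A *m clique_mx _ D)) v.
  move=> [h [H ->]].
  rewrite !mulmxA -trmx_mul -mulmxA /mxeval map_mxM -map_trmx.
  exact: qform_gram.
have qD (A B : 'M[R]_m) : qform (A + B) v = qform A v + qform B v.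
  by rewrite /qform mulmxDr mulmxDl mxE.
have qZ c (A : 'M[R]_m) : qform (c *: A) v = c * qform A v.
  by rewrite /qform -scalemxAr -scalemxAl mxE.
have q0 : qform 0 v = 0 by rewrite /qform mulmx0 mul0mx mxE.
have q_sum (J : finType) (A : J -> 'M[{mpoly R[n]}]_m) :
    (forall j, 0 <= qform (mxeval x (A j)) v) ->
    0 <= qform (mxeval x (\sum_j A j)) v.
  move=> hA; rewrite mxeval_sum.
  by elim/big_ind: _ => [|A1 A2 h1 h2|j _] //; rewrite ?q0 // qD addr_ge0.
rewrite eqS; apply: (q_sum) => k; rewrite mulmxDr mulmxDl mxevalD qD.
apply: addr_ge0; first by apply: gram_ge0; case: (sosS0 k).
rewrite mulmx_sumr mulmx_suml; apply: (q_sum) => j.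
rewrite -scalemxAr -scalemxAl mxevalZ qZ; apply: mulr_ge0; first exact: gx.
by apply: gram_ge0; case: (sosS j k).
Qed.

Hypothesis hchordal : chordal (sparsity_graph P0 P).
Hypothesis hC : enumerates_maximal_cliques (sparsity_graph P0 P) C.
Variable delta : nat.
Hypothesis hdeg : pencil_deg P0 P = (2 * delta)%N.

Lemma clique_mx_map D : clique_mx {mpoly R[n]} D = map_mx (@mpolyC n R) (clique_mx R (m := m) D).
Proof. by apply/matrixP => i j; rewrite !mxE rmorph_nat. Qed.

Lemma sos_feasible_of_posdef lam :
  (forall x : 'rV[R]_n, semialg g x -> posdef (mxeval x (pencil P0 P lam))) ->
  (forall x : 'rV[R]_n, x != 0 ->
     posdef (mxeval x (hom_part (2 * delta) (pencil P0 P lam)))) ->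
  exists N0, forall nu, (N0 <= nu)%N ->
    sos_feasible P0 P g C sigma (min_relax_order P0 P g nu) nu lam.
Proof.
move=> posK posT; pose E j := uphalf (mpdeg (g j)).
have Pdeg a b : (msize (pencil P0 P lam a b) <= (2 * delta).+1)%N.
  by rewrite -hdeg msize_pencil.
have gdeg j : (msize (g j) <= (2 * E j).+1)%N.
  by rewrite -mpdeg_msize /E; lia.
have [c [k [N0 cert]]] :=
  exists_certificate (trmx_pencil lam hP0 hP) Pdeg gdeg posK posT.
(* With N = nu + delta the exponent of sigma in the certificate is exactly [nu]. *)
exists N0 => nu Nnu; have Nnud : (N0 <= nu + delta)%N.
  by rewrite (leq_trans Nnu) // leq_addr.
have [dN EN [B [Bpsd Bsp Beq]]] := cert _ Nnud.
have clq (M : 'M[R]_m) : possemidef M -> sparse (sparsity_graph P0 P) M ->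
    exists D : forall i : 'I_t, 'M[R]_#|C i|,
      (forall i, exists h (H : 'M[R]_(h, #|C i|)), D i = H^T *m H) /\
      M = \sum_i (clique_mx R (C i))^T *m D i *m clique_mx R (C i).
  move=> Mpsd Msp; have [h [H ->]] := clique_gram_sum sparsity_graph_sym
    sparsity_graph_irr hchordal hC Mpsd Msp.
  by exists (fun i => (H i)^T *m H i); split=> // i; exists h, (H i).
have /choice [D DP] (w : {ffun 'I_(nu + delta) -> 'I_(dimU n)}) :
    exists D : forall i : 'I_t, 'M[R]_#|C i|,
      (forall i, exists h (H : 'M[R]_(h, #|C i|)), D i = H^T *m H) /\
      B w = \sum_i (clique_mx R (C i))^T *m D i *m clique_mx R (C i).
  apply: clq => // a b ab nab; apply: Bsp => //.
  exact: pencil_sparse.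
(* The multipliers of the [g j] are scalar multiples of the identity, which also splits along the
   cliques. *)
have [I [Igram Ieq]] : exists D : forall i : 'I_t, 'M[R]_#|C i|,
      (forall i, exists h (H : 'M[R]_(h, #|C i|)), D i = H^T *m H) /\
      1%:M = \sum_i (clique_mx R (C i))^T *m D i *m clique_mx R (C i).
  apply: clq; last by move=> i j /negbTE ij _; rewrite mxE ij.
  split=> [|v]; first by rewrite trmx1.
  by rewrite -/(qform _ v) -(mulmx1 1%:M) -{1}trmx1 qform_gram.
pose s j := sigma ^+ (nu + delta - E j * (2 * k).+1) *
  (sigma ^+ E j - c *: g j) ^+ (2 * k).
have relax_ge : (nu + delta <= min_relax_order P0 P g nu)%N.
  by rewrite /min_relax_order hdeg leq_add2l; lia.
exists (fun i => \sum_(w : {ffun 'I_(nu + delta) -> 'I_(dimU n)})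
  (\prod_j uroot R (w j)) ^+ 2 *: map_mx (@mpolyC n R) (D w i)),
  (fun j i => s j *: map_mx (@mpolyC n R) (I i)).
split=> [i|j i|].
- apply: (@sosle_sos_cone _ _ _ (2 * (nu + delta))); last by rewrite leq_mul2l.
  apply: sosle_sum => w; rewrite -[X in sosle X _]addn0.
  apply: sosle_sqr; first exact: msize_prod_uroot.
  by have [h [H ->]] := (DP w).1 i; apply: sosle_gram.
- have [h [H HE]] := Igram i.
  (* The bound adds up to [2 * (nu + delta - E j)], within the degree allowed for the multiplier of
     [g j]. *)
  apply: (@sosle_sos_cone _ _ _
    (2 * (nu + delta - E j * (2 * k).+1) + (2 * (2 * E j * k) + 0))); last first.
    by have := EN j; rewrite /E in relax_ge *; nia.
  rewrite /s -scalerA; apply: sosle_sigma; rewrite [in _ ^+ _]mulnC exprM.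
  apply: sosle_sqr; last by rewrite HE; apply: sosle_gram.
  apply: msizeX_leS; apply: msizeD_leS.
    exact: msizeX_leS (msize_one_plus_normsq R n).
  by rewrite msizeN (leq_trans (msizeZ_le _ _)).
rewrite addnK in Beq; rewrite Beq.
under [RHS]eq_bigr do rewrite mulmxDr mulmxDl.
rewrite big_split /=; congr (_ + _).
  under [RHS]eq_bigr do rewrite mulmx_sumr mulmx_suml.
  rewrite exchange_big; apply: eq_bigr => w _ /=.
  rewrite (DP w).2 map_mx_sum scaler_sumr; apply: eq_bigr => i _ /=.
  by rewrite !map_mxM clique_mx_map map_trmx -scalemxAr -scalemxAl.
rewrite -scalemx1; under [RHS]eq_bigr do rewrite mulmx_sumr mulmx_suml.
rewrite exchange_big scaler_suml; apply: eq_bigr => j _ /=.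
have -> : 1%:M = map_mx (@mpolyC n R) (1%:M : 'M[R]_m) by rewrite map_mx1.
rewrite Ieq map_mx_sum scaler_sumr; apply: eq_bigr => i _ /=.
rewrite !map_mxM clique_mx_map map_trmx.
by rewrite -!scalemxAr -!scalemxAl scalerA.
Qed.

End Pencil.

(** * Convergence *)

Local Open Scope classical_set_scope.

Lemma limn_esup_le_near (R : realType) (u : nat -> \bar R) (N0 : nat) (c : \bar R) :
  (forall nu, (N0 <= nu)%N -> (u nu <= c)%E) -> (limn_esup u <= c)%E.
Proof.
move=> hu; apply: (@le_trans _ _ (ereal_sup (u @` [set nu | (N0 <= nu)%N]))).
  by apply: ereal_inf_lbound; exists [set nu | (N0 <= nu)%N] => //; exists N0.
by apply: ge_ereal_sup => _ [nu Nnu <-]; apply: hu.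
Qed.

Lemma posdef_conv (R : realType) m (t : R) (A B : 'M[R]_m) :
  0 < t -> t <= 1 -> posdef A -> possemidef B ->
  posdef (t *: A + (1 - t) *: B).
Proof.
move=> t0 t1 [sA pA] [sB pB]; split=> [|v v0].
  by rewrite linearD /= !linearZ /= sA sB.
rewrite mulmxDr mulmxDl -!scalemxAr -!scalemxAl mxE [X in X + _]mxE [X in _ + X]mxE.
by rewrite ltr_wpDr ?mulr_ge0 ?mulr_gt0 ?pA ?pB // subr_ge0.
Qed.

Theorem theorem3p3 (R : realType) (n m l q t delta : nat)
    (b : 'rV[R]_l -> R)
    (P0 : 'M[{mpoly R[n]}]_m) (P : 'I_l -> 'M[{mpoly R[n]}]_m)
    (g : 'I_q -> {mpoly R[n]}) (C : 'I_t -> {set 'I_m})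
    (hb : convex_function [set: convex_lmodType 'rV[R]_l] b)
    (hP0 : P0^T = P0) (hP : forall i, (P i)^T = P i)
    (hchordal : chordal (sparsity_graph P0 P))
    (hC : enumerates_maximal_cliques (sparsity_graph P0 P) C)
    (hdeg : pencil_deg P0 P = (2 * delta)%N)
    (hinhom : ~ exists d : nat, pencil_homogeneous P0 P d)
    (htop : forall (lam : 'rV[R]_l) (x : 'rV[R]_n),
        possemidef (mxeval x (hom_part (2 * delta) (pencil P0 P lam))))
    (hstrict : exists lam0 : 'rV[R]_l,
        (forall x : 'rV[R]_n, semialg g x ->
           posdef (mxeval x (pencil P0 P lam0))) /\
        (forall x : 'rV[R]_n, x != 0 ->
           posdef (mxeval x (hom_part (2 * delta) (pencil P0 P lam0))))) :
  let B := pmi_value P0 P b g in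
  let Bsos (nu : nat) :=
    sos_value P0 P b g C (one_plus_normsq R n)
      (min_relax_order P0 P g nu) nu in
  (forall nu : nat, (B <= Bsos nu)%E) /\ (Bsos nu @[nu --> \oo] --> B).
Proof.
move=> B Bsos; have B_le nu : (B <= Bsos nu)%E.
  apply: ereal_inf_le_tmp => _ [lam flam <-]; exists lam => //.
  exact: (sos_feasible_sub_pmi hP0 hP flam).
(* Given the lower bound, it remains to bound the upper limit by [b lam + eps] for each feasible
   [lam]. *)
split=> //; apply: limn_esup_le_cvg B_le.
have [lam0 [posK posT]] := hstrict.
apply: le_ereal_inf_tmp => _ [lam flam <-].
apply/lee_addgt0Pr => eps eps0.
pose D := `|b lam0 - b lam|; have D0 : 0 <= D by apply: normr_ge0.
have eD : 0 < eps + D by rewrite ltr_pwDl.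
(* Small enough that s D <= eps, so convexity keeps [b mu] below [b lam + eps], yet positive, so
   that [mu] inherits strict feasibility from [lam0]. *)
pose s := eps / (eps + D); have s0 : 0 < s by apply: divr_gt0.
have s1 : s <= 1 by rewrite ler_pdivrMr // mul1r lerDl.
pose mu := s *: lam0 + (1 - s) *: lam.
have bmu : b mu <= b lam + eps.
  have := hb (Itv01 (ltW s0) s1) lam0 lam.
  rewrite !inE => /(_ I I) /= hmu; apply: le_trans hmu _.
  change (s * b lam0 + (1 - s) * b lam <= b lam + eps).
  have -> : s * b lam0 + (1 - s) * b lam = b lam + s * (b lam0 - b lam) by ring.
  rewrite lerD2l; apply: (@le_trans _ _ (s * D)).
    by rewrite ler_wpM2l ?ler_norm // ltW.
  by rewrite mulrAC ler_pdivrMr // ler_wpM2l // ?lerDr // ltW.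
have [||N0 hN0] := @sos_feasible_of_posdef _ _ _ _ _ _ hP0 hP _ g _ _ hchordal hC _
    hdeg mu.
- move=> x gx; rewrite /mu pencil_conv mxeval_conv.
  exact: posdef_conv s0 s1 (posK x gx) (flam x gx).
(* The leading form at [lam] is semidefinite by [htop]; mixing in the definite one at [lam0] makes
   it definite. *)
- move=> x x0; rewrite /mu pencil_conv hom_part_conv mxeval_conv.
  exact: posdef_conv s0 s1 (posT x x0) (htop lam x).
apply: (@limn_esup_le_near _ _ N0) => nu Nnu.
rewrite -EFinD; apply: (@le_trans _ _ (b mu)%:E); last by rewrite lee_fin.
by apply: ereal_inf_lbound; exists mu => //; apply: hN0.
Qed.
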